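(* Each right-angled virtual Artin group has the $R_\infty$-property. That is, for every finite simple graph $\Upsilon$ with at least one vertex, the right-angled virtual Artin group $VA(\Upsilon)$ satisfies $R(\phi)=\infty$ for every $\phi\in\mathrm{Aut}(VA(\Upsilon))$.
   Context: For a simple graph $\Upsilon$ with vertex set $V(\Upsilon)$ and edge set $E(\Upsilon)$, the right-angled virtual Artin group $VA(\Upsilon)$ is the group with generators $\sigma_s,\tau_s$ ($s\in V(\Upsilon)$) and defining relations $\tau_s^2=1$ for all $s\in V(\Upsilon)$, and $\tau_s\tau_t=\tau_t\tau_s$, $\sigma_s\sigma_t=\sigma_t\sigma_s$, $\tau_s\sigma_t=\sigma_t\tau_s$ whenever $(s,t)\in E(\Upsilon)$ (edges are unordered, so the last relation holds with $s$ and $t$ interchanged as well). (This is the virtual Artin group of the right-angled Coxeter matrix on $V(\Upsilon)$ with $m_{s,t}=2$ if $(s,t)\in E(\Upsilon)$ and $m_{s,t}=\infty$ otherwise, for $s\neq t$.) For a group $G$ and $\phi\in\mathrm{Aut}(G)$, elements $x,y\in G$ are $\phi$-conjugate if there is $g\in G$ with $x=g\,y\,\phi(g^{-1})$. The Reidemeister number $R(\phi)\in\mathbb{N}\cup\{\infty\}$ is the number of equivalence classes of this relation. The group $G$ has the $R_\infty$-property if $R(\phi)=\infty$ for every $\phi\in\mathrm{Aut}(G)$. *)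

(* Defs.v *)
From HB Require Import structures.
From mathcomp Require Import all_boot generic_quotient.
From mathcomp Require Import finmap.
From mathcomp Require Import boolp classical_sets functions cardinality.

Set Implicit Arguments.
Unset Strict Implicit.
Unset Printing Implicit Defensive.

Local Open Scope group_scope.

(* The group given by generators T and defining relations u = v, for u and v   *)
(* such that rel u v. A word is a sequence of letters; the letter (x, false)   *)
(* stands for the generator x, and (x, true) for its formal inverse.           *)
Definition word (T : Type) := seq (T * bool).

Section Presentation.
Variables (T : choiceType) (rel : word T -> word T -> Prop).

Inductive word_eq : word T -> word T -> Prop :=
| word_eq_refl u : word_eq u u
| word_eq_sym u v : word_eq u v -> word_eq v u
| word_eq_trans v u w : word_eq u v -> word_eq v w -> word_eq u w
| word_eq_cat u u' v v' :
    word_eq u u' -> word_eq v v' -> word_eq (u ++ v) (u' ++ v')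
| word_eq_cancel x b : word_eq [:: (x, b); (x, ~~ b)] [::]
| word_eq_rel u v : rel u v -> word_eq u v.

Definition word_eqb (u v : word T) : bool := `[< word_eq u v >].

Lemma word_eqb_refl : reflexive word_eqb.
Proof. by move=> u; apply/asboolP; apply: word_eq_refl. Qed.

Lemma word_eqb_sym : symmetric word_eqb.
Proof. by move=> u v; apply/asboolP/asboolP; apply: word_eq_sym. Qed.

Lemma word_eqb_trans : transitive word_eqb.
Proof.
by move=> v u w /asboolP uv /asboolP vw; apply/asboolP; apply: word_eq_trans vw.
Qed.

Canonical word_eqb_equiv :=
  EquivRel word_eqb word_eqb_refl word_eqb_sym word_eqb_trans.

Definition presented_group : Type := {eq_quot word_eqb}%qT.

HB.instance Definition _ := Choice.on presented_group.

Definition of_word (u : word T) : presented_group :=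
  (\pi_{eq_quot word_eqb} u)%qT.

Lemma of_wordP u v : of_word u = of_word v <-> word_eq u v.
Proof.
by split=> [/eqmodP/asboolP | uv] //; apply/eqmodP/asboolP.
Qed.

Definition to_word (g : presented_group) : word T := repr g.

Lemma to_wordK : cancel to_word of_word.
Proof. exact: reprK. Qed.

Definition word_inv (u : word T) : word T :=
  rev [seq (a.1, ~~ a.2) | a <- u].

Lemma word_invV u : word_eq (word_inv u ++ u) [::].
Proof.
elim: u => [|[x b] u IHu]; first exact: word_eq_refl.
rewrite /word_inv /= rev_cons cat_rcons -/(word_inv u).
apply: word_eq_trans IHu.
apply: word_eq_cat; first exact: word_eq_refl.
rewrite -[in X in word_eq _ X](cat0s u) -[_ :: _ :: u]/([:: _; _] ++ u).
apply: word_eq_cat; last exact: word_eq_refl.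
by have := word_eq_cancel x (~~ b); rewrite negbK.
Qed.

Lemma word_invK : involutive word_inv.
Proof.
move=> u; rewrite /word_inv map_rev revK -map_comp map_id_in // => -[x b] _ /=.
by rewrite negbK.
Qed.

Lemma word_inVv u : word_eq (u ++ word_inv u) [::].
Proof. by have := word_invV (word_inv u); rewrite word_invK. Qed.

Definition pres_mul (g h : presented_group) := of_word (to_word g ++ to_word h).
Definition pres_inv (g : presented_group) := of_word (word_inv (to_word g)).
Definition pres_one : presented_group := of_word [::].

Lemma to_of_word u : word_eq (to_word (of_word u)) u.
Proof. by apply/of_wordP; rewrite to_wordK. Qed.

Lemma pres_mulA : associative pres_mul.
Proof.
move=> x y z; apply/of_wordP.
apply: word_eq_trans (word_eq_cat (word_eq_refl _) (to_of_word _)) _.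
rewrite catA; apply: word_eq_cat; last exact: word_eq_refl.
by apply: word_eq_sym; apply: to_of_word.
Qed.

Lemma pres_mul1 : left_id pres_one pres_mul.
Proof.
move=> x; rewrite -[RHS]to_wordK; apply/of_wordP.
exact: (word_eq_cat (to_of_word [::]) (word_eq_refl _)).
Qed.

Lemma pres_mulr1 : right_id pres_one pres_mul.
Proof.
move=> x; rewrite -[RHS]to_wordK; apply/of_wordP.
have := word_eq_cat (word_eq_refl (to_word x)) (to_of_word [::]).
by rewrite cats0.
Qed.

Lemma pres_mulV : left_inverse pres_one pres_inv pres_mul.
Proof.
move=> x; apply/of_wordP; apply: word_eq_trans (word_invV (to_word x)).
exact: (word_eq_cat (to_of_word _) (word_eq_refl _)).
Qed.

Lemma pres_mulrV : right_inverse pres_one pres_inv pres_mul.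
Proof.
move=> x; apply/of_wordP; apply: word_eq_trans (word_inVv (to_word x)).
exact: (word_eq_cat (word_eq_refl _) (to_of_word _)).
Qed.

HB.instance Definition _ :=
  isGroup.Build presented_group pres_mulA pres_mul1 pres_mulr1 pres_mulV pres_mulrV.

Lemma of_wordM u v : of_word (u ++ v) = of_word u * of_word v.
Proof.
apply/of_wordP; apply: word_eq_sym.
exact: (word_eq_cat (to_of_word _) (to_of_word _)).
Qed.

End Presentation.

Section VirtualArtin.
Variables (V : finType) (e : rel V).

(* inl s is the generator sigma_s and inr s is the generator tau_s.            *)
Definition va_gen : choiceType := (V + V)%type.

Definition sigma_w (s : V) : word va_gen := [:: (inl s, false)].
Definition tau_w (s : V) : word va_gen := [:: (inr s, false)].

Inductive va_rel : word va_gen -> word va_gen -> Prop :=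
| va_tau2 s : va_rel (tau_w s ++ tau_w s) [::]
| va_tau_tau s t : e s t -> va_rel (tau_w s ++ tau_w t) (tau_w t ++ tau_w s)
| va_sigma_sigma s t :
    e s t -> va_rel (sigma_w s ++ sigma_w t) (sigma_w t ++ sigma_w s)
| va_tau_sigma s t :
    e s t -> va_rel (tau_w s ++ sigma_w t) (sigma_w t ++ tau_w s).

Definition VA : groupType := presented_group va_rel.

End VirtualArtin.

Section Reidemeister.
Local Open Scope classical_set_scope.
Variable G : groupType.

Definition twisted_conj (phi : G -> G) (x y : G) : Prop :=
  exists g : G, x = g * y * phi g^-1.

Definition twisted_class (phi : G -> G) (y : G) : set G :=
  [set x | twisted_conj phi x y].

Definition twisted_classes (phi : G -> G) : set (set G) :=
  range (twisted_class phi).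

(* The value None stands for infinity.                                         *)
Definition reidemeister (phi : G -> G) : option nat :=
  if `[< finite_set (twisted_classes phi) >]
  then Some #|` fset_set (twisted_classes phi) |%fset else None.

Definition Rinf_property : Prop :=
  forall phi : {multiplicative G -> G},
    bijective phi -> reidemeister phi = None.

End Reidemeister.

(* Main.v *)
From HB Require Import structures.
Require Import Defs.
From mathcomp Require Import all_boot all_order all_algebra all_fingroup.
From mathcomp Require Import zify boolp.
From mathcomp Require cardinality.

(* Write sigma_s, tau_s for the generators of G and lk s for the neighbours of s.
   Letting G act on reduced words whose letters are conjugates of one generator
   shows that an involution of G is a product of conjugates of pairwise adjacent
   distinct tau_t. Hence, if s has maximal degree, comparing centralizers modulo 2
   shows that every automorphism sends tau_s to a conjugate of some tau_t.

   Fix m = 2^k and let Q be the image of G under all homomorphisms to the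
   permutations of (Z/m)^V x {0, 1} that map the kernel of G -> (Z/m)^V to an
   elementary abelian 2-group. Every automorphism phi induces one on Q, and the
   conjugates of the tau_t are linearly independent in Q. So, if phi has o orbits
   on the classes of conjugates of tau_s, then phi fixes at least 2^o elements of Q
   whose centralizers have index at most m^|V|, and Burnside's lemma yields
   2^o <= R(phi) m^|V|. The conjugates of tau_s are indexed by (Z/m)^r, with
   r = |V| - |lk s|. For r >= 2 some phi^N with N = O(m) fixes all of them, so that o
   grows at least linearly in m. For r = 1 the first return of phi acts on
   Z/m by x |-> c + x or x |-> c - x; the second kind of map has orbits of
   bounded size, and in the first case phi preserves a nonzero homomorphism
   G -> Z, so that R(phi) is infinite. *)

Set Implicit Arguments.
Unset Strict Implicit.
Unset Printing Implicit Defensive.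

Import GRing.Theory.
Import GroupScope.
Local Open Scope group_scope.

(** A named head for composition, on which the monoid-law instance can be declared; folding words
    with it yields left actions of the group. *)
Definition self_comp (T : Type) (f g : T -> T) : T -> T := fun x => f (g x).

HB.instance Definition _ (T : Type) :=
  Monoid.isLaw.Build (T -> T) idfun (@self_comp T)
    (fun _ _ _ => erefl) (fun _ => erefl) (fun _ => erefl).

(** * Homomorphisms out of a virtual Artin group *)

Section PresentationFold.
Variables (T : choiceType) (rel : word T -> word T -> Prop).
Variables (R : Type) (idx : R) (op : Monoid.law idx) (F : T * bool -> R).
Hypothesis F_cancel : forall x b, op (F (x, b)) (F (x, ~~ b)) = idx.
Hypothesis F_rel : forall u v, rel u v ->
  \big[op/idx]_(a <- u) F a = \big[op/idx]_(a <- v) F a.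

(** The fold runs over a chosen representative word; by [word_eq_fold] the choice is immaterial,
    which makes this the homomorphism extending [F]. *)
Definition pres_fold (g : presented_group rel) : R :=
  \big[op/idx]_(a <- to_word g) F a.

Lemma word_eq_fold u v : word_eq rel u v ->
  \big[op/idx]_(a <- u) F a = \big[op/idx]_(a <- v) F a.
Proof.
elim=> //; last 1 first.
- by move=> x b; rewrite big_cons big_seq1 big_nil.
- by move=> {}u {}v w _ -> _ ->.
- by move=> {}u u' {}v v' _ IHu _ IHv; rewrite !big_cat IHu IHv.
Qed.

Lemma pres_fold_word u : pres_fold (of_word rel u) = \big[op/idx]_(a <- u) F a.
Proof. exact/word_eq_fold/to_of_word. Qed.

Lemma pres_foldM g h : pres_fold (g * h) = op (pres_fold g) (pres_fold h).
Proof. by rewrite -big_cat -pres_fold_word of_wordM !to_wordK. Qed.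

End PresentationFold.

Section VirtualArtinGroup.
Variables (V : finType) (e : rel V).

Local Notation G := (VA e).

Definition letter (x : V + V) (b : bool) : G := of_word (@va_rel V e) [:: (x, b)].
Definition gen x := letter x false.
Definition sigma s := gen (inl s).
Definition tau s := gen (inr s).
Definition vertex (x : V + V) : V := match x with inl s | inr s => s end.

Lemma letterV x : letter x true = (gen x)^-1.
Proof.
apply/esym/(@mulg1_eq G); rewrite -(@of_wordM _ (@va_rel V e)).
exact/of_wordP/word_eq_cancel.
Qed.

Lemma va_ind (P : G -> Prop) :
  P 1 -> (forall x b g, P g -> P (letter x b * g)) -> forall g, P g.
Proof.
move=> P1 PM g; rewrite -[g]to_wordK; elim: (to_word g) => [|[x b] u IHu].
  exact: P1.
by rewrite (of_wordM _ [:: (x, b)]); apply: PM.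
Qed.

Lemma tau2 s : tau s * tau s = 1.
Proof. by rewrite -(@of_wordM _ (@va_rel V e)); apply/of_wordP/word_eq_rel/va_tau2. Qed.

Lemma tauV s : (tau s)^-1 = tau s.
Proof. exact/mulg1_eq/tau2. Qed.

Hypothesis e_sym : symmetric e.

Lemma gen_commute x y : e (vertex x) (vertex y) -> commute (gen x) (gen y).
Proof.
rewrite /commute -!(@of_wordM _ (@va_rel V e)) => exy.
move: x y exy => [s|s] [t|t] /= est; apply/of_wordP.
- exact/word_eq_rel/va_sigma_sigma.
- by apply/word_eq_sym/word_eq_rel/va_tau_sigma; rewrite e_sym.
- exact/word_eq_rel/va_tau_sigma.
- exact/word_eq_rel/va_tau_tau.
Qed.

Section Fold.
Variables (R : Type) (idx : R) (op : Monoid.law idx) (F : V + V -> bool -> R).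
Hypothesis F_cancel : forall x b, op (F x b) (F x (~~ b)) = idx.
Hypothesis F_tau : forall s, op (F (inr s) false) (F (inr s) false) = idx.
Hypothesis F_comm : forall x y, e (vertex x) (vertex y) ->
  op (F x false) (F y false) = op (F y false) (F x false).

Definition va_fold : G -> R :=
  @pres_fold _ (@va_rel V e) _ _ op (fun a => F a.1 a.2).

Fact va_fold_rel u v : @va_rel V e u v ->
  \big[op/idx]_(a <- u) F a.1 a.2 = \big[op/idx]_(a <- v) F a.1 a.2.
Proof.
by case=> *; rewrite !big_cat /= !big_seq1 ?big_nil /=;
  [exact: F_tau | exact: F_comm..].
Qed.

Lemma va_foldM g h : va_fold (g * h) = op (va_fold g) (va_fold h).
Proof. by apply: pres_foldM; [move=> x b; apply: F_cancel | exact: va_fold_rel]. Qed.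

Lemma va_fold_letter x b : va_fold (letter x b) = F x b.
Proof.
rewrite /va_fold pres_fold_word ?big_seq1 //; exact: va_fold_rel.
Qed.

Lemma va_fold1 : va_fold 1 = idx.
Proof.
rewrite /va_fold pres_fold_word ?big_nil //; exact: va_fold_rel.
Qed.

End Fold.

End VirtualArtinGroup.

(** * Involutions *)

Section ReducedWords.
Variable H : groupType.
Implicit Types (x y z : H) (L M : seq H).

Definition reduced L := sorted (fun x y => y != x^-1) L.

(** Left multiplication by the letter [y] in a free product, where a letter may be its own inverse.
    Words that are not reduced are left alone, so that [push y] is a bijection of all of [seq H]. *)
Definition push y L :=
  if reduced L then
    (if L is z :: L' then if z == y^-1 then L' else y :: L else [:: y])
  else L.

Definition eval L : H := \prod_(y <- L) y.

Lemma reduced_behead y L : reduced (y :: L) -> reduced L.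
Proof. by case: L => //= z L /andP[]. Qed.

Lemma reduced_push y L : reduced L -> reduced (push y L).
Proof.
rewrite /push => Lr; rewrite Lr; case: L Lr => //= z L Lr.
by case: eqP => [_|/eqP zy]; [exact: reduced_behead Lr | rewrite /reduced /= zy].
Qed.

Lemma pushE y L : reduced L ->
  push y L = if L is z :: L' then if z == y^-1 then L' else y :: L else [:: y].
Proof. by rewrite /push => ->. Qed.

Lemma pushK y : cancel (push y) (push y^-1).
Proof.
move=> L; case: (boolP (reduced L)) => Lr; last first.
  by rewrite /push (negPf Lr) (negPf Lr).
rewrite pushE ?reduced_push // pushE //.
case: L Lr => [|z L] Lr; first by rewrite invgK eqxx.
case: eqP => [zy|_]; last by rewrite invgK eqxx.
case: L Lr => [|z' L] Lr; first by rewrite zy.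
case: eqP => [z'y|_]; last by rewrite zy.
by move: Lr; rewrite /reduced /= zy -z'y eqxx.
Qed.

Lemma eval_push y L : reduced L -> eval (push y L) = y * eval L.
Proof.
rewrite /push => ->; case: L => [|z L]; first by rewrite /eval big_cons.
by case: eqP => [->|_]; rewrite /eval !big_cons // mulKVg.
Qed.

Lemma push_cons y L : reduced (y :: L) -> push y L = y :: L.
Proof.
move=> yL; rewrite /push (reduced_behead yL); case: L yL => //= z L.
by rewrite /reduced /= => /andP[/negPf ->].
Qed.

Lemma foldr_push_nil L : reduced L -> foldr push [::] L = L.
Proof.
elim: L => //= y L IHL yL; rewrite IHL ?(reduced_behead yL) //.
exact: push_cons.
Qed.

Lemma foldr_pushP y M K : reduced K ->
  foldr push M (push y K) = push y (foldr push M K).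
Proof.
rewrite /push => Kr; rewrite Kr -/(push _ _).
case: K Kr => [|z K] Kr //=; case: eqP => [->|_ //].
by rewrite -[X in push X](invgK y) pushK.
Qed.

(** Undoing the pushes of [L] one by one turns the empty word back into [M], and pushing a reduced
    word onto the empty word merely spells it. *)
Lemma foldr_push_nilP M L :
  reduced M -> reduced L -> foldr push M L = [::] -> M = rev ([seq y^-1 | y <- L]).
Proof.
move=> Mr Lr ML.
have {ML} : M = foldr push [::] (rev ([seq y^-1 | y <- L])).
  rewrite -ML; elim: L {Lr ML} => //= y L IHL.
  by rewrite rev_cons foldr_rcons pushK.
rewrite foldr_push_nil // /reduced rev_sorted sorted_map.
apply: sub_sorted Lr => x y; apply: contra => /eqP xy.
by rewrite -[y]invgK -xy.
Qed.

Lemma mem_push x y L : x \in push y L -> x = y \/ x \in L.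
Proof.
rewrite /push; case: ifP => _; last by right.
case: L => [|z L]; first by rewrite inE => /eqP; left.
case: ifP => _; first by rewrite in_cons => ->; rewrite orbT; right.
by rewrite in_cons => /predU1P.
Qed.

Section Morphism.
Variable f : H -> H.
Hypotheses (f_inj : injective f) (fV : {morph f : x / x^-1}).

Lemma reduced_map L : reduced (map f L) = reduced L.
Proof.
rewrite /reduced sorted_map; apply: eq_sorted => x y /=.
by rewrite -fV inj_eq.
Qed.

Lemma map_push y L : map f (push y L) = push (f y) (map f L).
Proof.
rewrite /push reduced_map; case: ifP => // _; case: L => //= z L.
by rewrite -fV inj_eq //; case: eqP.
Qed.

End Morphism.

Lemma map_conjg_push a y L :
  map (conjg^~ a) (push y L) = push (y ^ a) (map (conjg^~ a) L).
Proof. by apply: map_push => [|x]; [exact: conjg_inj | rewrite conjVg]. Qed.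

Lemma map_foldr_push a M L : map (conjg^~ a) (foldr push L M) =
  foldr push (map (conjg^~ a) L) (map (conjg^~ a) M).
Proof. by elim: M => //= y M <-; rewrite map_conjg_push. Qed.

Lemma eval_map_conjg a L : eval (map (conjg^~ a) L) = eval L ^ a.
Proof. by rewrite /eval big_map conjg_prod. Qed.

Lemma reduced_map_conjg a L : reduced (map (conjg^~ a) L) = reduced L.
Proof. by apply: reduced_map => [|x]; [exact: conjg_inj | rewrite conjVg]. Qed.

(* The word L is a palindrome twisted by conjugation by c; peeling it from both *)
(* ends leaves nothing or one letter, which c conjugates to its inverse.        *)
Lemma eval_twisted_palindrome c L : c * c = 1 ->
  map (conjg^~ c) L = rev ([seq y^-1 | y <- L]) ->
  exists u, eval L * c = c ^ u \/
    exists2 y, y \in L & eval L * c = (y * c) ^ u /\ y ^ c = y^-1.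
Proof.
move=> c2; have cV : c^-1 = c by apply: mulg1_eq.
have [n] := ubnP (size L); elim: n L => // n IHn [|y L] /=.
  by move=> _ _; exists 1; left; rewrite /eval big_nil mul1g conjg1.
case/lastP: L => [|L z] szL; first last.
  rewrite map_rcons rev_cons map_rcons rev_rcons rcons_cons.
  move=> /eqP; rewrite eqseq_cons eqseq_rcons => /and3P[/eqP yz /eqP LL _].
  have zE : z = c * y^-1 * c by rewrite -[z]invgK -yz conjgE cV !invgM cV.
  have [|u Hu] := IHn L _ LL.
    by move: szL; rewrite size_rcons; lia.
  (* Since [z] is [c * y^-1 * c], the two outer letters together conjugate the inner product by
     [y^-1]. *)
  have evE : eval (y :: rcons L z) * c = (eval L * c) ^ y^-1.
    rewrite /eval big_cons -cats1 big_cat big_seq1 /= zE conjgE invgK.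
    by rewrite !mulgA -[_ * c * c]mulgA c2 mulg1.
  exists (u * y^-1); case: Hu => [Hu|[x xL [Hu xc]]].
    by left; rewrite evE Hu conjgM.
  right; exists x; first by rewrite in_cons mem_rcons in_cons xL !orbT.
  by rewrite evE Hu conjgM.
move=> [yc]; exists 1; right; exists y; first exact: mem_head.
by rewrite /eval big_seq1 conjg1 yc.
Qed.

End ReducedWords.

(** * Killing one generator, and the action on reduced words *)

Section KillGenerator.
Variables (V : finType) (e : rel V).
Hypothesis e_sym : symmetric e.

Local Notation G := (VA e).
Local Notation letter := (@letter V e).
Local Notation gen := (@gen V e).
Local Notation tau := (@tau V e).

Variable v : (V + V)%type.

Definition kill_letter x b : G := if x == v then 1 else letter x b.

Definition kill : G -> G := va_fold [the Monoid.law _ of @mul G] kill_letter.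

Lemma letter_cancel x b : letter x b * letter x (~~ b) = 1.
Proof. by case: b; rewrite /= letterV -/(gen x) ?mulVg ?mulgV. Qed.

Fact kill_spec : [/\ {morph kill : g h / g * h}, kill 1 = 1 &
  forall x b, kill (letter x b) = kill_letter x b].
Proof.
have Kc x b : kill_letter x b * kill_letter x (~~ b) = 1.
  by rewrite /kill_letter; case: eqP; rewrite ?mulg1 ?letter_cancel.
have Kt s : kill_letter (inr s) false * kill_letter (inr s) false = 1.
  by rewrite /kill_letter; case: eqP; rewrite ?mulg1 ?tau2.
have Kr x y : e (vertex x) (vertex y) -> kill_letter x false * kill_letter y false =
    kill_letter y false * kill_letter x false.
  rewrite /kill_letter; do 2![case: eqP => ?]; rewrite ?mulg1 ?mul1g // => exy.
  exact: gen_commute.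
split=> [g h||x b].
- exact: (va_foldM (op := [the Monoid.law _ of @mul G])).
- exact: (va_fold1 (op := [the Monoid.law _ of @mul G])).
- exact: (va_fold_letter (op := [the Monoid.law _ of @mul G])).
Qed.

(* Reduced words stand for the elements x of the kernel of [kill], a free product *)
(* of cyclic groups, on which g acts by x |-> g * x * (kill g)^-1.                *)
Definition wact_letter x b (L : seq G) : seq G :=
  if x == v then push (letter v b) L else map (conjg^~ (letter x b)^-1) L.

Definition wact : G -> seq G -> seq G :=
  va_fold [the Monoid.law _ of @self_comp (seq G)] wact_letter.

Fact wact_spec : [/\ forall g h L, wact (g * h) L = wact g (wact h L),
  forall L, wact 1 L = L & forall x b, wact (letter x b) = wact_letter x b].
Proof.
have mapcc (a b : G) (L : seq G) :
    map (conjg^~ a) (map (conjg^~ b) L) = map (conjg^~ (b * a)) L.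
  by rewrite -map_comp; apply: eq_map => y /=; rewrite conjgM.
have mapc1 (L : seq G) : map (conjg^~ (1 : G)) L = L.
  by rewrite -[RHS]map_id; apply: eq_map => y; rewrite conjg1.
have Kc x b : self_comp (wact_letter x b) (wact_letter x (~~ b)) = idfun.
  apply: funext => L; rewrite /self_comp /wact_letter /=; case: eqP => _.
    have -> : letter v b = (letter v (~~ b))^-1.
      by apply/esym/mulg1_eq; have := letter_cancel v (~~ b); rewrite negbK.
    exact: pushK.
  by rewrite mapcc -invgM letter_cancel invg1 mapc1.
have Kt s : self_comp (wact_letter (inr s) false) (wact_letter (inr s) false) = idfun.
  apply: funext => L; rewrite /self_comp /wact_letter /=; case: eqP => [<-|_].
    by have := pushK (tau s) L; rewrite tauV.
  by rewrite mapcc -invgM tau2 invg1 mapc1.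
have Kr x y : e (vertex x) (vertex y) ->
    self_comp (wact_letter x false) (wact_letter y false) =
    self_comp (wact_letter y false) (wact_letter x false).
  move=> exy; apply: funext => L; rewrite /self_comp /wact_letter.
  have cxy : letter x false * letter y false = letter y false * letter x false.
    exact: gen_commute.
  case: (eqVneq x v) => [xv|_]; case: (eqVneq y v) => [yv|_] //.
  - rewrite map_conjg_push; congr push.
    by rewrite conjgE invgK -xv mulgA -cxy mulgK.
  - rewrite map_conjg_push; congr push.
    by rewrite conjgE invgK -yv mulgA cxy mulgK.
  - by rewrite !mapcc -!invgM cxy.
split=> [g h L|L|x b].
- by rewrite /wact (va_foldM (op := [the Monoid.law _ of @self_comp (seq G)])).
- by rewrite /wact (va_fold1 (op := [the Monoid.law _ of @self_comp (seq G)])).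
- exact: (va_fold_letter (op := [the Monoid.law _ of @self_comp (seq G)])).
Qed.

Lemma kill1 : kill 1 = 1. Proof. by case: kill_spec. Qed.
Lemma killM : {morph kill : g h / g * h}. Proof. by case: kill_spec. Qed.
Lemma kill_gen x : kill (gen x) = if x == v then 1 else gen x.
Proof. by case: kill_spec => _ _ ->. Qed.

Lemma wactP g : let L := wact g [::] in
  [/\ reduced L,
      eval L * kill g = g,
      forall M, wact g M = foldr (@push G) (map (conjg^~ (kill g)^-1) M) L &
      forall y, y \in L -> exists a b, y = letter v b ^ a].
Proof.
have [wM w1 wl] := wact_spec; have [kM k1 kl] := kill_spec.
elim/va_ind: g => [|x b g [Lr evL LM Lc]] L.
  rewrite /L w1 k1 mulg1; split=> // [|M]; first by rewrite /eval big_nil.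
  by rewrite w1 invg1 (eq_map (@conjg1 G)) map_id.
rewrite /L wM wl kM kl /wact_letter /kill_letter; case: eqP => [xv|xv].
  rewrite xv.
  split; first exact: reduced_push.
  - by rewrite eval_push // mul1g -mulgA evL.
  - by move=> M; rewrite wM wl /wact_letter eqxx LM mul1g foldr_pushP.
  - by move=> y /mem_push[->|/Lc//]; exists 1, b; rewrite conjg1.
split; first by rewrite reduced_map_conjg.
- rewrite eval_map_conjg conjgE invgK -[in RHS]evL !mulgA.
  by rewrite mulgVK.
- move=> M; rewrite wM wl /wact_letter ifN; last by apply/eqP.
  rewrite LM map_foldr_push -map_comp; congr foldr.
  by apply: eq_map => y /=; rewrite invgM conjgM.
- move=> _ /mapP[y /Lc[a [c ->]] ->].
  by exists (a * (letter x b)^-1), c; rewrite conjgM.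
Qed.

(** As [g] squares to 1, acting twice on the empty word returns it, so the word of [g] conjugated by
    [kill g] is the formal inverse of that word; peeling this twisted palindrome gives the two
    cases. *)
Lemma involution_kill g : g * g = 1 ->
  exists u, g = kill g ^ u \/
    exists a b, g = (letter v b ^ a * kill g) ^ u /\
      (letter v b ^ a) ^ kill g = (letter v b ^ a)^-1.
Proof.
move=> g2; have [wM w1 _] := wact_spec.
have [Lr evL LM Lc] := wactP g.
have k2 : kill g * kill g = 1 by rewrite -killM g2 kill1.
have := LM (wact g [::]); rewrite -wM g2 w1 (mulg1_eq k2) => /esym L2.
have := foldr_push_nilP _ Lr L2; rewrite reduced_map_conjg => /(_ Lr) Lpal.
have [u] := eval_twisted_palindrome k2 Lpal.
rewrite evL => -[gE|[y /Lc[a [b ->]] [gE cE]]]; exists u; first by left.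
by right; exists a, b.
Qed.

End KillGenerator.

(** * Involutions as products of conjugates of the tau generators *)

Section Involutions.
Variables (V : finType) (e : rel V).
Hypothesis e_sym : symmetric e.

Local Notation G := (VA e).
Local Notation letter := (@letter V e).
Local Notation gen := (@gen V e).
Local Notation tau := (@tau V e).
Local Notation sigma := (@sigma V e).

Definition ab_letter (x : V + V) (b : bool) : {ffun V -> int} :=
  match x with
  | inl s => [ffun t => if t == s then (-1) ^+ b else 0]%R
  | inr _ => 0%R
  end.

Definition ab : G -> {ffun V -> int} :=
  va_fold [the Monoid.law _ of @GRing.add {ffun V -> int}] ab_letter.

Fact ab_spec : [/\ forall g h, ab (g * h) = (ab g + ab h)%R, ab 1 = 0%R &
  forall x b, ab (letter x b) = ab_letter x b].
Proof.
have Kc x b : (ab_letter x b + ab_letter x (~~ b))%R = 0%R.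
  case: x => [s|s]; last by rewrite /= addr0.
  by apply/ffunP => t; rewrite !ffunE; case: eqP => _; case: b.
split=> [g h||x b].
- apply: (va_foldM (op := [the Monoid.law _ of @GRing.add {ffun V -> int}])) => //.
    by move=> s; rewrite /= addr0.
  by move=> x y _; rewrite /= addrC.
- apply: (va_fold1 (op := [the Monoid.law _ of @GRing.add {ffun V -> int}])) => //.
    by move=> s; rewrite /= addr0.
  by move=> x y _; rewrite /= addrC.
- apply: (va_fold_letter (op := [the Monoid.law _ of @GRing.add {ffun V -> int}])) => //.
    by move=> s; rewrite /= addr0.
  by move=> y z _; rewrite /= addrC.
Qed.

Lemma abM g h : ab (g * h) = (ab g + ab h)%R.
Proof. by case: ab_spec. Qed.

Lemma ab1 : ab 1 = 0%R.
Proof. by case: ab_spec. Qed.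

Lemma abV g : ab g^-1 = (- ab g)%R.
Proof. by apply/eqP; rewrite -addr_eq0 -abM mulVg ab1. Qed.

Lemma abJ g h : ab (g ^ h) = ab g.
Proof. by rewrite conjgE !abM abV addrC addrK. Qed.

Lemma ab_sigma s t : ab (sigma s) t = (t == s)%:R%R.
Proof. by case: ab_spec => _ _ ->; rewrite ffunE; case: eqP. Qed.

Lemma ab_tau s : ab (tau s) = 0%R.
Proof. by case: ab_spec => _ _ ->. Qed.

Definition tau_prod (l : seq (G * V)) : G := \prod_(p <- l) (tau p.2 ^ p.1).

Lemma tau_prodJ l h : tau_prod l ^ h = tau_prod [seq (p.1 * h, p.2) | p <- l].
Proof.
by rewrite /tau_prod conjg_prod big_map; apply: eq_bigr => p _; rewrite conjgM.
Qed.

(** The generators are killed one after another. Undoing one step adds at most one conjugate of that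
    generator to the product, and as [l] has no repetition the vertices stay distinct. *)
Lemma involution_kills_tau_prod (l : seq (V + V)) g : g * g = 1 -> uniq l ->
  foldl (fun h x => kill x h) g l = 1 ->
  exists p, [/\ uniq (unzip2 p), {in unzip2 p, forall t, inr t \in l} &
    g = tau_prod p].
Proof.
elim: l g => [|x l IHl] g g2 /= => [_ ->|/andP[xl ul] gl].
  by exists [::]; rewrite /tau_prod big_nil.
have k2 : kill x g * kill x g = 1 by rewrite -(killM e_sym) g2 (kill1 e_sym).
have [p [pu pl pE]] := IHl _ k2 ul gl.
have [u [gE|[a [b [gE bE]]]]] := involution_kill e_sym x g2.
  exists [seq (q.1 * u, q.2) | q <- p]; rewrite -tau_prodJ -pE.
  have -> : unzip2 [seq (q.1 * u, q.2) | q <- p] = unzip2 p by rewrite /unzip2 -map_comp.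
  by split=> // t /pl; rewrite inE => ->; rewrite orbT.
case: x xl gl k2 pE gE bE => [s|s] xl gl k2 pE gE bE.
  (* A conjugate of [sigma s] or of its inverse is never conjugate to its own inverse: the exponent
     sums at [s] differ. *)
  have := congr1 (fun g => ab g s) bE; rewrite abV !abJ.
  by case: ab_spec => _ _ ->; rewrite !ffunE eqxx; case: (b).
exists [seq (q.1 * u, q.2) | q <- (a, s) :: p]; rewrite -tau_prodJ /=.
have -> : unzip2 [seq (q.1 * u, q.2) | q <- p] = unzip2 p by rewrite /unzip2 -map_comp.
split=> [|t|].
- by rewrite pu andbT; apply: contra xl => /pl.
- by rewrite !inE => /predU1P[->|/pl ->]; rewrite ?eqxx ?orbT.
- rewrite gE /tau_prod big_cons -/(tau_prod _) -pE /=.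
  by case: (b); rewrite // letterV tauV.
Qed.

Lemma involution_tau_prod g : g * g = 1 ->
  exists2 p, uniq (unzip2 p) & g = tau_prod p.
Proof.
move=> g2.
pose ks := foldl (fun (h : G) x => kill x h).
have ks1 l : ks 1 l = 1 by elim: l => //= x l IHl; rewrite (kill1 e_sym).
have ksM l h k : ks (h * k) l = ks h l * ks k l.
  by elim: l h k => //= x l IHl h k; rewrite (killM e_sym) IHl.
have ks_gen l x : x \in l -> ks (gen x) l = 1.
  elim: l => //= y l IHl; rewrite inE (kill_gen e_sym).
  by case: eqP => [_ _|_ /= /IHl //]; exact: ks1.
have gk : ks g (enum {: V + V}) = 1.
  elim/va_ind: g {g2} => [|x b g IHg]; first exact: ks1.
  rewrite ksM IHg mulg1; case: b; rewrite ?ks_gen ?mem_enum //.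
  rewrite letterV -[LHS]mulg1 -[X in _ * X](ks_gen (enum {: V + V}) x) ?mem_enum //.
  by rewrite -ksM mulVg ks1.
by have [p [pu _ pE]] := involution_kills_tau_prod g2 (enum_uniq _) gk; exists p.
Qed.

Section Dihedral.
Variables (t u : V).
Hypotheses (tu : t != u) (etu : ~~ e t u).

(* In the infinite dihedral group acting on Z, a product of one conjugate of   *)
(* each of the two reflections is a nontrivial translation, not an involution. *)
Definition dih_letter (x : V + V) (b : bool) (z : int) : int :=
  (if x == inr t then - z else if x == inr u then 1 - z else z)%R.

Definition dih : G -> int -> int :=
  va_fold [the Monoid.law _ of @self_comp int] dih_letter.

Fact dih_spec : [/\ forall g h z, dih (g * h) z = dih g (dih h z),
  forall z, dih 1 z = z & forall x b, dih (letter x b) = dih_letter x b].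
Proof.
have Kc x b : self_comp (dih_letter x b) (dih_letter x (~~ b)) = idfun.
  apply: funext => z; rewrite /self_comp /dih_letter /=.
  by case: eqP => _; [|case: eqP => _]; lia.
have Kt s : self_comp (dih_letter (inr s) false) (dih_letter (inr s) false) = idfun.
  exact: Kc.
have Kr x y : e (vertex x) (vertex y) ->
    self_comp (dih_letter x false) (dih_letter y false) =
    self_comp (dih_letter y false) (dih_letter x false).
  move=> exy; apply: funext => z; rewrite /self_comp /dih_letter.
  case: (eqVneq x (inr t)) exy => [->|_]; case: (eqVneq y (inr t)) => [->|_] //.
  - by case: (eqVneq y (inr u)) => [->|_] //=; rewrite (negPf etu).
  - by case: (eqVneq x (inr u)) => [->|_] //=; rewrite e_sym (negPf etu).
  - by case: (x == _); case: (y == _).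
split=> [g h z|z|x b].
- by rewrite /dih (va_foldM (op := [the Monoid.law _ of @self_comp int])).
- by rewrite /dih (va_fold1 (op := [the Monoid.law _ of @self_comp int])).
- exact: (va_fold_letter (op := [the Monoid.law _ of @self_comp int])).
Qed.

Lemma dih_affine g : exists (b : bool) (c : int),
  forall z, dih g z = ((if b then - z else z) + c)%R.
Proof.
have [dM d1 dl] := dih_spec.
elim/va_ind: g => [|x b g [b' [c IHg]]].
  by exists false, 0%R => z; rewrite d1 addr0.
have dE z : dih (letter x b * g) z = dih_letter x b ((if b' then - z else z) + c)%R.
  by rewrite dM dl IHg.
move: dE; rewrite /dih_letter; case: eqP => _; last case: eqP => _; move=> dE.
- by exists (~~ b'), (- c)%R => z; rewrite dE; case: (b') => /=; lia.
- by exists (~~ b'), (1 - c)%R => z; rewrite dE; case: (b') => /=; lia.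
- by exists b', c => z; rewrite dE.
Qed.

(** Conjugation changes the constant of a reflection by an even number, so its parity separates the
    conjugates of [tau t] from those of [tau u]. *)
Lemma dih_tauJ w a : exists k : int, forall z,
  dih (tau w ^ a) z = (if (w == t) || (w == u) then 2%:Z * k + (w == u)%:Z - z else z)%R.
Proof.
have [dM d1 dl] := dih_spec.
have [b [c dE]] := dih_affine a.
have dV z : dih a^-1 z = (if b then c - z else z - c)%R.
  have := d1 z; rewrite -(mulgV a) dM dE.
  by case: (b) => /=; lia.
have dw z : dih (tau w) z = dih_letter (inr w) false z by rewrite dl.
have ttE (s : V) : (inr w == inr s :> V + V) = (w == s) by [].
have tuF : w == t -> (w == u) = false by move=> /eqP ->; rewrite (negPf tu).
exists (if w == u then if b then c - 1 else - c else if b then c else - c)%R => z.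
rewrite conjgE !dM dw dE dV /dih_letter !ttE.
by case: (w == t) tuF => [-> //|_]; case: (w == u); case: (b) => /=; lia.
Qed.

Lemma dih_tau_prod p : uniq (unzip2 p) -> exists k : int, forall z,
  dih (tau_prod p) z = (2%:Z * k + (u \in unzip2 p)%:Z +
    (if (t \in unzip2 p) (+) (u \in unzip2 p) then - z else z))%R.
Proof.
have [dM d1 dl] := dih_spec.
elim: p => [_|[a w] p IHp /= /andP[wp /IHp[k dE]]].
  exists 0%R => z; rewrite /tau_prod big_nil d1 /=; lia.
have [j jE] := dih_tauJ w a.
rewrite !inE [t == _]eq_sym [u == _]eq_sym.
have pE z : dih (tau_prod ((a, w) :: p)) z = dih (tau w ^ a) (dih (tau_prod p) z).
  by rewrite /tau_prod big_cons dM.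
case: (eqVneq w t) jE wp pE => [->|wt] jE tp pE.
  rewrite (negPf tu) /= in jE *; rewrite (negPf tp) in dE *.
  exists (j - k - (u \in unzip2 p)%:Z)%R => z; rewrite pE dE jE.
  by case: (u \in _) => /=; lia.
case: (eqVneq w u) jE tp pE => [->|wu] jE up pE.
  rewrite (negPf up) in dE *.
  exists (j - k)%R => z; rewrite pE dE jE.
  by case: (t \in _) => /=; lia.
by exists k => z; rewrite pE dE jE.
Qed.

End Dihedral.

(** Were [t] and [u] not adjacent, the product would act on the integers as a translation by an odd
    number, whose square is not the identity. *)
Lemma tau_prod_clique p : uniq (unzip2 p) -> tau_prod p * tau_prod p = 1 ->
  {in unzip2 p &, forall t u, t != u -> e t u}.
Proof.
move=> pu p2 t u tp up tu; apply/negPn/negP => etu.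
have [dM d1 _] := dih_spec tu etu.
have [k dE] := dih_tau_prod tu etu pu.
have := d1 0%R; rewrite -p2 dM !dE tp up /=; lia.
Qed.

End Involutions.

(** * Images of the tau_s under automorphisms *)

Lemma intr_Zp_eq0 q (z : int) : (z%:~R == 0 :> 'Z_q.+2)%R = (q.+2%:Z %| z)%Z.
Proof.
have nat0 n : (n%:R == 0 :> 'Z_q.+2)%R = (q.+2 %| n).
  by rewrite -val_eqE /= val_Zp_nat.
by case: z => n; rewrite ?NegzE ?rmorphN /= ?oppr_eq0 -pmulrn nat0 dvdzE ?abszN.
Qed.

(** * Permutation actions on vectors modulo q + 2 *)

Section Shifts.
Variables (V : finType) (e : rel V) (q : nat).
Hypothesis e_sym : symmetric e.

Local Notation G := (VA e).
Local Notation letter := (@letter V e).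
Local Notation tau := (@tau V e).
Local Notation sigma := (@sigma V e).
Local Notation Zq := ('Z_q.+2).
Local Notation ZV := {ffun V -> Zq}.
Local Notation X := (ZV * bool)%type.

Definition abm (g : G) : ZV := [ffun v => (ab g v)%:~R]%R.

Lemma abmM g h : abm (g * h) = (abm g + abm h)%R.
Proof. by apply/ffunP => v; rewrite !ffunE abM ffunE rmorphD. Qed.

Lemma abm1 : abm 1 = 0%R.
Proof. by apply/ffunP => v; rewrite !ffunE ab1 ffunE. Qed.

Lemma abmV g : abm g^-1 = (- abm g)%R.
Proof. by apply/eqP; rewrite -addr_eq0 -abmM mulVg abm1. Qed.

Lemma abm_tau s : abm (tau s) = 0%R.
Proof. by apply/ffunP => v; rewrite !ffunE ab_tau ffunE. Qed.

Lemma abmJ g h : abm (g ^ h) = abm g.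
Proof. by apply/ffunP => v; rewrite !ffunE abJ. Qed.

Lemma abm_sigma s : abm (sigma s) = [ffun t => (t == s)%:R]%R.
Proof. by apply/ffunP => v; rewrite !ffunE ab_sigma; case: eqP. Qed.

Definition abm_section (z : ZV) : G := \prod_(t : V) (sigma t ^+ z t).

Lemma abm_sectionK z : abm (abm_section z) = z.
Proof.
have abmX g n : abm (g ^+ n) = (abm g *+ n)%R.
  by elim: n => [|n IHn]; rewrite ?mulr0n ?expg0 ?abm1 // expgS abmM IHn mulrS.
rewrite /abm_section (big_morph abm abmM abm1).
apply/ffunP => v; rewrite sum_ffunE (bigD1 v) //= big1 => [|t tv].
  by rewrite abmX abm_sigma ffunMnE ffunE eqxx addr0 /= natr_Zp.
by rewrite abmX abm_sigma ffunMnE ffunE eq_sym (negPf tv) mul0rn.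
Qed.

Lemma commute_abm_section (x : G) (z : ZV) :
  (forall t, z t != 0%R -> commute x (sigma t)) -> commute x (abm_section z).
Proof.
move=> xz; apply: commute_prod => t _.
have [->|zt] := eqVneq (z t) 0%R; first by rewrite expg0; exact: commute1.
exact/commuteX/xz.
Qed.

Variable u : V.

Definition supp_link (z : ZV) : bool := [forall v, e u v || (z v == 0%R)].

Definition shift_fun (a : ZV) (x : X) : X := ((x.1 + a)%R, x.2).
Definition flip_fun (x : X) : X := (x.1, x.2 (+) supp_link x.1).

Fact shift_inj a : injective (shift_fun a).
Proof. by move=> [y b] [z c] [/addIr -> ->]. Qed.

Fact flip_inj : injective flip_fun.
Proof. by move=> [y b] [z c] [-> /addIb ->]. Qed.

Definition shift_letter (x : V + V) (b : bool) : {perm X} :=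
  match x with
  | inl s => perm (@shift_inj [ffun t => (-1) ^+ b * (t == s)%:R]%R)
  | inr s => if s == u then perm flip_inj else 1
  end.

(** Each [sigma] translates the vectors, and [tau u] flips the bit over those supported on the link
    of [u]. This set is invariant under the translations by [sigma t] for [t] in the link, as the
    relations demand. *)
Definition shift : G -> {perm X} :=
  va_fold [the Monoid.law _ of @mul {perm X}] shift_letter.

Lemma supp_linkD z a : supp_link a -> supp_link (z + a)%R = supp_link z.
Proof.
move=> /forallP sa; apply: eq_forallb => v; rewrite ffunE.
by have := sa v; case: (e u v) => //= /eqP ->; rewrite addr0.
Qed.

Fact shift_spec : [/\ {morph shift : g h / g * h}, shift 1 = 1 &
  forall x b, shift (letter x b) = shift_letter x b].
Proof.
have Kt s : shift_letter (inr s) false * shift_letter (inr s) false = 1.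
  rewrite /=; case: eqP => _; last by rewrite mulg1.
  by apply/permP => -[z b]; rewrite permM !permE /flip_fun /= addbK.
have Kc x b : shift_letter x b * shift_letter x (~~ b) = 1.
  case: x => s; last exact: Kt.
  apply/permP => -[z c]; rewrite permM !permE /shift_fun /=; congr pair.
  by apply/ffunP => t; rewrite !ffunE signrN mulNr addrK.
have Kst s t : e s t -> shift_letter (inr s) false * shift_letter (inl t) false =
    shift_letter (inl t) false * shift_letter (inr s) false.
  rewrite /=; case: eqP => [->|_]; last by rewrite mulg1 mul1g.
  move=> eut; apply/permP => -[z c]; rewrite !permM !permE /shift_fun /flip_fun /=.
  rewrite supp_linkD //; apply/forallP => v; rewrite ffunE mul1r.
  by case: (eqVneq v t) => [->|_]; rewrite ?eut ?eqxx ?orbT.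
have Kr x y : e (vertex x) (vertex y) -> shift_letter x false * shift_letter y false =
    shift_letter y false * shift_letter x false.
  case: x y => s [] t /= est.
  - apply/permP => -[z c]; rewrite !permM !permE /shift_fun /=.
    by rewrite addrAC.
  - by apply/esym/Kst; rewrite e_sym.
  - exact: Kst.
  - by case: eqP => _; case: eqP => _; rewrite ?mulg1 ?mul1g.
split=> [g h||x b].
- exact: (va_foldM (op := [the Monoid.law _ of @mul {perm X}])).
- exact: (va_fold1 (op := [the Monoid.law _ of @mul {perm X}])).
- exact: (va_fold_letter (op := [the Monoid.law _ of @mul {perm X}])).
Qed.

Lemma shiftM : {morph shift : g h / g * h}.
Proof. by case: shift_spec. Qed.

Lemma shift1 : shift 1 = 1.
Proof. by case: shift_spec. Qed.

Lemma shiftE g z b : shift g (z, b) = ((z + abm g)%R, b (+) (shift g (z, false)).2).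
Proof.
have [_ _ sl] := shift_spec; have [_ _ al] := ab_spec e.
elim/va_ind: g z b => [|x c g IHg] z b; first by rewrite shift1 !perm1 abm1 addr0 addbF.
rewrite shiftM !permM sl /=; case: x => s /=.
  rewrite permE /shift_fun /= IHg abmM addrA; congr (_ + _ + _, _)%R.
    apply/ffunP => t; rewrite !ffunE al ffunE.
    by case: eqP => _; rewrite ?mulr0 ?mulr1 ?rmorph0 // rmorphXn rmorphN.
  by rewrite permE.
have -> : abm (letter (inr s) c * g) = abm g.
  apply/ffunP => t; rewrite !ffunE abM ffunE.
  by rewrite al ffunE add0r.
case: (s == u); rewrite ?permE ?perm1 /= /flip_fun /= IHg //.
by rewrite [X in (_, _ (+) X.2)]IHg /= addbA.
Qed.

Lemma shift_tauJ w a z b : shift (tau w ^ a) (z, b) =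
  (z, b (+) ((w == u) && [forall v, e u v || (z v == abm a v)])).
Proof.
have [_ _ sl] := shift_spec.
rewrite conjgE !shiftM !permM shiftE abmV sl /=.
have -> : [forall v, e u v || (z v == abm a v)] = supp_link (z - abm a)%R.
  by apply: eq_forallb => v; rewrite !ffunE subr_eq0.
have aK : (shift a ((z - abm a)%R, false)).2 = (shift a^-1 (z, false)).2.
  have : (shift (a^-1 * a) (z, false)).2 = false by rewrite mulVg shift1 perm1.
  rewrite shiftM permM [shift a^-1 _]shiftE shiftE abmV /=.
  by case: (shift a^-1 _).2; case: (shift a _).2.
case: eqP => _; rewrite ?permE ?perm1 /flip_fun /= shiftE subrK aK; congr pair.
  by rewrite -!addbA [X in _ (+) X]addbCA addbb addbF.
by rewrite -addbA addbb.
Qed.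

Lemma shift_tau_prod p z b : uniq (unzip2 p) -> shift (tau_prod p) (z, b) =
  (z, b (+) has (fun c => (c.2 == u) && [forall v, e u v || (z v == abm c.1 v)]) p).
Proof.
rewrite /tau_prod; elim: p b => [|[a w] p IHp] b /=.
  by rewrite big_nil shift1 perm1 addbF.
move=> /andP[wp /IHp IH]; rewrite big_cons shiftM permM shift_tauJ IH /= -addbA.
congr (_, _ (+) _); case: eqP wp => //= -> up.
rewrite (_ : has _ p = false) ?addbF ?orbF //.
apply/negbTE/hasPn => -[c t] ctp /=; apply/nandP; left.
by apply: contra up => /eqP <-; apply/mapP; exists (c, t).
Qed.

(** The vectors over which the product flips the bit form one coset: those agreeing with [abm a] off
    the link of [u]. An element [y] commuting with the product preserves this coset while
    translating by [abm y]. *)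
Lemma abm_commute_tau_prod p a y v : uniq (unzip2 p) -> (a, u) \in p ->
  commute y (tau_prod p) -> ~~ e u v -> abm y v = 0%R.
Proof.
move=> pu ap yp euv.
have hasE z : has (fun c => (c.2 == u) && [forall v, e u v || (z v == abm c.1 v)]) p =
    [forall v, e u v || (z v == abm a v)].
  apply/hasP/idP => [[[c w] /= cp /andP[/eqP wu]]|za]; last first.
    by exists (a, u); rewrite /= ?eqxx.
  suff -> : c = a by [].
  move: pu ap cp; rewrite wu; elim: (p) => //= -[d t] p' IH /andP[tp pu'].
  rewrite !inE => /predU1P[[ad ut]|ap] /predU1P[[cd tE]|cp].
  - by rewrite ad cd.
  - by case/mapP: tp; exists (c, u).
  - by case/mapP: tp; exists (a, u).
  - exact: IH.
have := congr1 (fun g => shift g (abm a, false)) yp.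
rewrite !shiftM !permM shift_tau_prod // hasE.
rewrite (_ : [forall v, _] = true); last by apply/forallP => w; rewrite eqxx orbT.
rewrite (shiftE y _ true) [shift y (_, false)]surjective_pairing.
have -> : (shift y (abm a, false)).1 = (abm a + abm y)%R by rewrite shiftE.
rewrite shift_tau_prod // hasE => -[] H.
have /forallP/(_ v) : [forall v, e u v || ((abm a + abm y)%R v == abm a v)].
  by move: H; case: (shift y _).2; case: [forall v, _].
by rewrite (negPf euv) ffunE eq_sym -subr_eq0 opprD addNKr oppr_eq0 => /eqP.
Qed.

End Shifts.

(** * Automorphisms and vertices of maximal degree *)

Definition is_aut (G : groupType) (f : G -> G) : Prop :=
  {morph f : x y / x * y} /\ bijective f.

Section Automorphisms.
Variables (V : finType) (e : rel V).
Hypothesis e_sym : symmetric e.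
Hypothesis e_irr : irreflexive e.

Local Notation G := (VA e).
Local Notation letter := (@letter V e).
Local Notation gen := (@gen V e).
Local Notation tau := (@tau V e).
Local Notation sigma := (@sigma V e).

Section Morphism.
Variable psi : G -> G.
Hypothesis psiM : {morph psi : x y / x * y}.

Lemma morph1g : psi 1 = 1.
Proof. by apply: (@mulgI _ (psi 1)); rewrite -psiM !mulg1. Qed.

Lemma morphVg g : psi g^-1 = (psi g)^-1.
Proof. by apply/esym/mulg1_eq; rewrite -psiM mulgV morph1g. Qed.

Lemma morphJg g h : psi (g ^ h) = psi g ^ psi h.
Proof. by rewrite !conjgE !psiM morphVg. Qed.

Lemma ab_morph_tau t : ab (psi (tau t)) = 0%R.
Proof.
apply/ffunP => v; have : ab (psi (tau t * tau t)) v = 0%R.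
  by rewrite tau2 morph1g ab1 ffunE.
by rewrite psiM abM !ffunE; move: (ab _ _) => x; lia.
Qed.

(** The images of the [tau] generators square to 1 and so have zero exponent sums; thus [psi] acts
    on exponent sums by an integer matrix. *)
Lemma ab_morph g v : ab (psi g) v = (\sum_s ab g s * ab (psi (sigma s)) v)%R.
Proof.
elim/va_ind: g => [|x b g IHg].
  by rewrite morph1g ab1 ffunE big1 // => s _; rewrite ffunE mul0r.
rewrite psiM abM ffunE IHg.
rewrite [RHS](eq_bigr (fun s => ab (letter x b) s * ab (psi (sigma s)) v +
    ab g s * ab (psi (sigma s)) v)%R); last first.
  by move=> s _; rewrite abM ffunE mulrDl.
rewrite big_split /=; congr (_ + _)%R.
have -> : ab (psi (letter x b)) v = ((-1) ^+ b * ab (psi (gen x)) v)%R.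
  case: b; last by rewrite mul1r.
  by rewrite letterV morphVg abV ffunE mulN1r.
have [_ _ ->] := ab_spec e; case: x => [s|s] /=.
  rewrite (bigD1 s) //= big1 => [|t /negPf ts].
    by rewrite ffunE eqxx addr0.
  by rewrite ffunE ts mul0r.
rewrite ab_morph_tau ffunE mulr0 big1 // => t _.
by rewrite ffunE mul0r.
Qed.

Lemma abm_morph q g h : abm q g = abm q h -> abm q (psi g) = abm q (psi h).
Proof.
move=> /ffunP gh; apply/ffunP => v; rewrite !ffunE !ab_morph !rmorph_sum /=.
by apply: eq_bigr => s _; rewrite !rmorphM /=; have := gh s; rewrite !ffunE => ->.
Qed.

Lemma morph_section_commute q s (z : {ffun V -> 'Z_q.+2}) :
  (forall v, z v != 0%R -> e s v) ->
  commute (psi (abm_section e z)) (psi (tau s)).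
Proof.
move=> zs; rewrite /commute -!psiM; congr psi.
apply/esym/commute_abm_section => t /zs est.
by apply: gen_commute.
Qed.

End Morphism.

Definition link (s : V) : {set V} := [set v | e s v].

Lemma tau_neq1 s : tau s != 1.
Proof.
apply/eqP => t1; have := shift_tauJ e_sym s s 1 (0%R : {ffun V -> 'Z_2}) false.
rewrite conjg1 t1 shift1 // perm1 eqxx /= => -[] /esym/negP[].
by apply/forallP => v; rewrite abm1 eqxx orbT.
Qed.

Lemma ab_commute_tau_prod (p : seq (G * V)) a t y v : uniq (unzip2 p) -> (a, t) \in p ->
  commute y (tau_prod p) -> ~~ e t v -> ab y v = 0%R.
Proof.
move=> pu ap yp etv; apply/eqP; rewrite -absz_eq0.
have dv q : (q.+2 %| absz (ab y v))%N.
  rewrite -[q.+2]/(absz (Posz q.+2)) -dvdzE -intr_Zp_eq0.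
  rewrite (_ : ((ab y v)%:~R)%R = abm q y v); last by rewrite ffunE.
  by rewrite (abm_commute_tau_prod q e_sym pu ap yp etv).
(* The modulus |ab y v| + 2 exceeds the number it divides, which is therefore 0. *)
have := dv (absz (ab y v)); apply: contraTT; rewrite -lt0n => y0.
by apply/negP => /dvdn_leq -/(_ y0); lia.
Qed.

(** Modulo 2, [psi] induces an injection from vectors supported on the link of [s] to vectors
    supported on the common neighbours [S] of the factors of [psi (tau s)]. Maximality of the degree
    makes [S] the link of each factor; two factors would be adjacent, putting a vertex in its own
    link. *)
Lemma aut_tau psi s : is_aut psi -> (forall t, #|link t| <= #|link s|) ->
  exists a t, [/\ psi (tau s) = tau t ^ a, #|link t| = #|link s| &
    forall y v, commute y (psi (tau s)) -> ~~ e t v -> ab y v = 0%R].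
Proof.
move=> [psiM [psi' psiK psi'K]] smax.
have psi'M : {morph psi' : x y / x * y}.
  by move=> x y; apply: (can_inj psiK); rewrite psiM !psi'K.
have g2 : psi (tau s) * psi (tau s) = 1 by rewrite -psiM tau2 (morph1g psiM).
have [p pu gE] := involution_tau_prod e_sym g2.
pose S := [set v | all (e^~ v) (unzip2 p)].
have cardS : #|link s| <= #|S|.
  pose f (z : {ffun V -> 'Z_2}) := abm 0 (psi (abm_section e z)).
  have f_inj : injective f.
    move=> y z /(abm_morph psi'M); rewrite !psiK !abm_sectionK //.
  have : [set f z | z in pffun_on 0%R (link s) predT] \subset
      [set z in pffun_on (0%R : 'Z_2) S predT].
    apply/subsetP => _ /imsetP[z /pffun_onP[zs _] ->]; rewrite inE.
    apply/pffun_onP; split=> //; apply/subsetP => v; rewrite !inE => fzv.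
    apply/allP => _ /mapP[[a t] ap ->] /=; apply: contraNT fzv => etv.
    rewrite /f (abm_commute_tau_prod _ e_sym pu ap) // -gE.
    apply: morph_section_commute => // w zw.
    by have := subsetP zs w zw; rewrite inE.
  move=> /subset_leq_card; rewrite card_imset // [X in _ <= X]cardsE.
  by rewrite !card_pffun_on card_ord leq_exp2l.
have linkS a t : (a, t) \in p -> S = link t.
  move=> ap; apply/eqP; rewrite eqEcard (leq_trans (smax t) cardS) andbT.
  apply/subsetP => v; rewrite !inE => /allP/(_ t); apply.
  by apply/mapP; exists (a, t).
case: p => [|[a t] [|[b u] p]] in pu gE S cardS linkS *.
- have := tau_neq1 s; rewrite -(psiK (tau s)) gE /tau_prod big_nil.
  by rewrite (morph1g psi'M) eqxx.
- exists a, t; rewrite gE /tau_prod big_seq1; split=> //.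
    apply/eqP; rewrite eqn_leq smax -(linkS a t) ?mem_head //.
  move=> y v yt etv.
    apply: (ab_commute_tau_prod (p := [:: (a, t)]) (a := a) (t := t)) => //.
    exact: mem_head.
  by rewrite /tau_prod big_seq1.
- have tu : t != u by move: pu; rewrite /= inE negb_or => /andP[/andP[]].
  have g2' := g2; rewrite gE in g2'.
  have := tau_prod_clique e_sym pu g2'.
  move=> /(_ t u); rewrite !inE !eqxx orbT => /(_ isT isT tu) etu.
  have : u \in link u.
    have <- : S = link u by apply: (linkS b); rewrite !inE eqxx orbT.
    by rewrite (linkS a t) ?mem_head // inE.
  by rewrite inE e_irr.
Qed.

End Automorphisms.

(** * Counting twisted classes in a finite quotient *)

Lemma perm_prodg_commute (H : monoidType) (l1 l2 : seq H) :
  {in l1 &, forall x y, commute x y} -> perm_eq l1 l2 ->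
  \prod_(x <- l1) x = \prod_(x <- l2) x.
Proof.
elim: l1 l2 => [|x l1 IHl] l2 lc pl; first by move: pl; rewrite perm_sym => /perm_nilP ->.
have xl2 : x \in l2 by rewrite -(perm_mem pl) mem_head.
case/splitPr: xl2 pl => a b pl.
have pl' : perm_eq l1 (a ++ b).
  by move: pl; rewrite perm_sym -[x :: b]cat1s perm_catCA /= perm_cons perm_sym.
rewrite big_cons (IHl (a ++ b)) // => [|y z yl zl]; last first.
  by apply: lc; rewrite inE ?yl ?zl orbT.
rewrite !big_cat big_cons /= !mulgA; congr (_ * _).
rewrite [\prod_(i <- a) i]big_seq; apply: commute_prod => y ya.
by apply: lc; rewrite ?mem_head // inE (perm_mem pl') mem_cat ya orbT.
Qed.

Section FiniteQuotient.
Variables (V : finType) (e : rel V) (q : nat).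
Hypothesis e_sym : symmetric e.

Local Notation G := (VA e).
Local Notation gen := (@gen V e).
Local Notation tau := (@tau V e).
Local Notation Zq := ('Z_q.+2).
Local Notation ZV := {ffun V -> Zq}.
Local Notation X := (ZV * bool)%type.
Local Notation abm := (@abm V e q).

Definition nice (k : G -> {perm X}) : Prop :=
  [/\ {morph k : g h / g * h},
      forall g h, abm g = 0%R -> abm h = 0%R -> commute (k g) (k h) &
      forall g, abm g = 0%R -> k g * k g = 1].

Lemma morph_gen_eq (k k' : G -> {perm X}) :
  {morph k : g h / g * h} -> {morph k' : g h / g * h} ->
  (forall x, k (gen x) = k' (gen x)) -> k =1 k'.
Proof.
move=> kM k'M kk'.
have m1 (f : G -> {perm X}) : {morph f : g h / g * h} -> f 1 = 1.
  by move=> fM; apply: (@mulgI _ (f 1)); rewrite -fM !mulg1.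
have mV (f : G -> {perm X}) g : {morph f : g h / g * h} -> f g^-1 = (f g)^-1.
  by move=> fM; apply/esym/(@mulg1_eq {perm X}); rewrite -fM mulgV m1.
elim/va_ind => [|x b g IHg]; first by rewrite !m1.
by rewrite kM k'M IHg; case: b; rewrite ?letterV ?mV // kk'.
Qed.

Definition nice_images (j : {ffun V + V -> {perm X}}) : bool :=
  `[< exists2 k, nice k & forall x, k (gen x) = j x >].

(** A homomorphism is determined by the images of the generators, so this finite type indexes all
    the nice ones. *)
Definition index_type := {j | nice_images j}.

Lemma rep_subproof (j : index_type) :
  exists k, nice k /\ forall x, k (gen x) = val j x.
Proof. by case/asboolP: (valP j) => k kn kE; exists k. Qed.

Definition rep (j : index_type) : G -> {perm X} := sval (cid (rep_subproof j)).

Lemma rep_nice j : nice (rep j).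
Proof. by rewrite /rep; case: cid => k []. Qed.

Lemma rep_gen j x : rep j (gen x) = val j x.
Proof. by rewrite /rep; case: cid => k []. Qed.

Lemma repM j : {morph rep j : g h / g * h}.
Proof. by case: (rep_nice j). Qed.

Lemma rep_surj k : nice k -> exists j, rep j =1 k.
Proof.
move=> kn; have jn : nice_images [ffun x => k (gen x)].
  by apply/asboolP; exists k => // x; rewrite ffunE.
exists (Sub _ jn); apply: morph_gen_eq; [exact: repM | by case: kn|].
by move=> x; rewrite rep_gen SubK ffunE.
Qed.

Lemma shift_nice u : nice (shift (e := e) q u).
Proof.
have [be sE] : exists be, forall g z b, abm g = 0%R ->
    shift q u g (z, b) = (z, b (+) be g z).
  exists (fun g z => (shift q u g (z, false)).2) => g z b g0.
  by rewrite shiftE // g0 addr0.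
split=> [|g h g0 h0|g g0]; first exact: shiftM.
  by apply/permP => -[z b]; rewrite !permM !sE // addbAC.
by apply/permP => -[z b]; rewrite permM !sE // addbK perm1.
Qed.

Local Notation Y := (index_type * X)%type.

Definition ev_fun (g : G) (y : Y) : Y := (y.1, rep y.1 g y.2).

Fact ev_inj g : injective (ev_fun g).
Proof. by move=> [j x] [j' x'] [<- /perm_inj ->]. Qed.

(** All nice homomorphisms act at once, each on its own copy of [X]. *)
Definition ev (g : G) : {perm Y} := perm (@ev_inj g).

Lemma evE g j x : ev g (j, x) = (j, rep j g x).
Proof. by rewrite permE. Qed.

Lemma evM : {morph ev : g h / g * h}.
Proof. by move=> g h; apply/permP => -[j x]; rewrite permM !evE repM permM. Qed.

Lemma ev1 : ev 1 = 1.
Proof. by apply: (@mulgI _ (ev 1)); rewrite -evM !mulg1. Qed.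

Lemma evV g : ev g^-1 = (ev g)^-1.
Proof. by apply/esym/(@mulg1_eq {perm Y}); rewrite -evM mulgV ev1. Qed.

Lemma evJ g h : ev (g ^ h) = ev g ^ ev h.
Proof. by rewrite !conjgE !evM evV. Qed.

Lemma ev_commute g h : abm g = 0%R -> abm h = 0%R -> commute (ev g) (ev h).
Proof.
move=> g0 h0; rewrite /commute -!evM; apply/permP => -[j x].
by have [_ cj _] := rep_nice j; rewrite !evE !repM cj.
Qed.

(** The difference of [abm a] and [abm b] is supported on the link of [t], so it lifts to some [w]
    commuting with [tau t]. Then [w * b] agrees with [a] under [abm], and the discrepancy lies in
    the kernel of [abm], whose image is commutative. *)
Lemma ev_tauJ_eq t a b : (forall v, ~~ e t v -> abm a v = abm b v) ->
  ev (tau t ^ a) = ev (tau t ^ b).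
Proof.
move=> ab_eq; pose w := abm_section e (abm a - abm b)%R.
have cw : commute (tau t) w.
  have zE v : ((abm a - abm b) v = abm a v - abm b v)%R by rewrite !ffunE.
  apply: commute_abm_section => v; rewrite zE subr_eq0 => abv.
  apply: gen_commute => //=; apply: contraNT abv => /ab_eq ->.
  exact: eqxx.
have -> : tau t ^ b = tau t ^ (w * b).
  by rewrite conjgM [tau t ^ w]conjgE cw mulKg.
have -> : tau t ^ (w * b) = (tau t ^ (w * b * a^-1)) ^ a.
  by rewrite -conjgM mulgVK.
rewrite !evJ; congr (_ ^ _); rewrite conjgE ev_commute ?mulKg ?abm_tau //.
by rewrite !abmM abmV abm_sectionK subrK subrr.
Qed.

Definition Q : {set {perm Y}} := [set p | `[< exists g, p = ev g >]].
Definition U : {set {perm Y}} := [set p | `[< exists2 g, abm g = 0%R & p = ev g >]].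

Lemma evQ g : ev g \in Q.
Proof. by rewrite inE; apply/asboolP; exists g. Qed.

Lemma QP p : reflect (exists g, p = ev g) (p \in Q).
Proof. by rewrite inE; apply: asboolP. Qed.

Lemma evU g : abm g = 0%R -> ev g \in U.
Proof. by move=> g0; rewrite inE; apply/asboolP; exists g. Qed.

Lemma UP p : reflect (exists2 g, abm g = 0%R & p = ev g) (p \in U).
Proof. by rewrite inE; apply: asboolP. Qed.

Fact Q_group_set : group_set Q.
Proof.
apply/group_setP; split=> [|_ _ /QP[g ->] /QP[h ->]]; last by rewrite -evM evQ.
by rewrite -ev1 evQ.
Qed.

Canonical Q_group := Group Q_group_set.

Lemma sub_UQ : U \subset Q.
Proof. by apply/subsetP => _ /UP[g _ ->]; apply: evQ. Qed.

Lemma card_Q : #|Q| <= #|U| * #|{: ZV}|.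
Proof.
rewrite -[#|{: ZV}|]cardsT -cardsX.
apply: leq_trans (leq_imset_card (fun c => c.1 * ev (abm_section e c.2)) _).
apply/subset_leq_card/subsetP => _ /QP[g ->]; apply/imsetP.
exists (ev (g * (abm_section e (abm g))^-1), abm g) => /=; last first.
  by rewrite -evM mulgVK.
by rewrite in_setX /= in_setT andbT evU // abmM abmV abm_sectionK subrr.
Qed.

(* A conjugate tau_w ^ b flips the point (abm a, false) iff w = t and b agrees  *)
(* with a off the link of t, i.e. iff it has the same image as tau_t ^ a.       *)
Lemma ev_tau_detect t a : exists det : {perm Y} -> bool,
  [/\ {in U &, {morph det : p r / p * r >-> p (+) r}}, det 1 = false &
    forall w b, det (ev (tau w ^ b)) = (ev (tau w ^ b) == ev (tau t ^ a))].
Proof.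
have [j jE] := rep_surj (shift_nice t).
exists (fun p => (p (j, (abm a, false))).2.2); split=> [|| w b].
- move=> _ _ /UP[g g0 ->] /UP[h h0 ->].
  by rewrite permM !evE /= !jE shiftE // g0 addr0 shiftE //= h0.
- by rewrite perm1.
have tauE c : (ev (tau w ^ c) (j, (abm a, false))).2.2 =
    (w == t) && [forall v, e t v || (abm a v == abm c v)].
  by rewrite evE /= jE shift_tauJ.
apply/idP/eqP => [|bE].
  rewrite tauE => /andP[/eqP -> /forallP ab]; apply: ev_tauJ_eq => v etv.
  by have := ab v; rewrite (negPf etv) => /eqP.
rewrite bE evE /= jE shift_tauJ // eqxx /=.
by apply/forallP => v; rewrite eqxx orbT.
Qed.

Definition taus : {set {perm Y}} := [set p | `[< exists t a, p = ev (tau t ^ a) >]].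

Lemma tausP p : reflect (exists t a, p = ev (tau t ^ a)) (p \in taus).
Proof. by rewrite inE; apply: asboolP. Qed.

Lemma taus_sub : taus \subset U.
Proof.
by apply/subsetP => _ /tausP[t [a ->]]; apply: evU; rewrite abmJ abm_tau.
Qed.

Lemma U_commute : {in U &, forall p r, commute p r}.
Proof. by move=> _ _ /UP[g g0 ->] /UP[h h0 ->]; apply: ev_commute. Qed.

Lemma UM : {in U &, forall p r, p * r \in U}.
Proof. by move=> _ _ /UP[g g0 ->] /UP[h h0 ->]; rewrite -evM evU // abmM g0 h0 addr0. Qed.

Lemma U1 : 1 \in U.
Proof. by rewrite -ev1 evU // abm1. Qed.

Definition prod_taus (A : {set {perm Y}}) : {perm Y} := \prod_(p <- enum A) p.

Lemma prod_tausU (A : {set {perm Y}}) : A \subset taus -> prod_taus A \in U.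
Proof.
move=> At; rewrite /prod_taus big_seq.
apply: (big_ind (fun p => p \in U)) => //; [exact: U1 | exact: UM |].
by move=> p; rewrite mem_enum => /(subsetP At)/(subsetP taus_sub).
Qed.

(** Linear independence over the field with two elements: the detector of [x] is additive and reads
    off from the product over a set whether [x] belongs to it. *)
Lemma prod_taus_inj (A B : {set {perm Y}}) : A \subset taus -> B \subset taus ->
  prod_taus A = prod_taus B -> A = B.
Proof.
suff sub (C D : {set {perm Y}}) : C \subset taus -> D \subset taus ->
    prod_taus C = prod_taus D -> C \subset D.
  move=> At Bt AB; apply/eqP.
  by rewrite eqEsubset (sub A B At Bt AB) (sub B A Bt At (esym AB)).
move=> Ct Dt CD; apply/subsetP => x xC.
have /tausP[t [a xE]] := subsetP Ct x xC.
have [det [dM d1 dt]] := ev_tau_detect t a.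
have detP (l : seq {perm Y}) : uniq l -> {subset l <= taus} ->
    \prod_(p <- l) p \in U /\ det (\prod_(p <- l) p) = (x \in l).
  elim: l => [|p l IHl] /=; first by rewrite big_nil U1 d1.
  move=> /andP[pl ul] lt; have pt : p \in taus by apply: lt; rewrite mem_head.
  have [|lU ldet] := IHl ul; first by move=> r rl; apply: lt; rewrite inE rl orbT.
  have pU := subsetP taus_sub p pt.
  rewrite big_cons UM // dM // ldet in_cons; split=> //.
  case/tausP: pt pl => w [b ->]; rewrite dt -xE [x == _]eq_sym.
  by case: eqP => [-> /negPf ->|].
have detC (E : {set {perm Y}}) : E \subset taus -> det (prod_taus E) = (x \in E).
  move=> Et; rewrite -mem_enum; apply: (detP _ (enum_uniq E) _).2 => p.
  by rewrite mem_enum => /(subsetP Et).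
by rewrite -detC // -CD detC.
Qed.

Lemma prod_taus_fixed (A : {set {perm Y}}) s : A \subset taus -> A :^ s = A ->
  prod_taus A ^ s = prod_taus A.
Proof.
move=> At As; rewrite /prod_taus conjg_prod -(big_map (conjg^~ s) xpredT id) /=.
apply/esym/perm_prodg_commute => [x y|].
  rewrite !mem_enum => /(subsetP At)/(subsetP taus_sub) xU.
  by move=> /(subsetP At)/(subsetP taus_sub) yU; apply: U_commute.
apply: uniq_perm; rewrite ?enum_uniq ?map_inj_uniq ?enum_uniq //; first exact: conjg_inj.
move=> x; rewrite mem_enum -{1}As; apply/imsetP/mapP => -[y yA ->]; exists y => //.
  by rewrite mem_enum.
by rewrite mem_enum in yA.
Qed.

(** * The permutation induced by an automorphism *)

Section Twisted.
Variable phi : G -> G.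
Hypothesis phiA : is_aut phi.

Let phiM : {morph phi : x y / x * y}. Proof. by case: phiA. Qed.

(** [phi] preserves the kernel of [abm], so precomposing with it keeps a homomorphism nice. *)
Lemma pullback_subproof (j : index_type) : exists j', rep j' =1 rep j \o phi.
Proof.
have [kM kC k2] := rep_nice j.
have abm_phi g : abm g = 0%R -> abm (phi g) = 0%R.
  move=> g0; rewrite (abm_morph phiM (h := 1)) ?(morph1g phiM) ?abm1 //.
apply: rep_surj; split=> [g h|g h g0 h0|g g0] /=; first by rewrite phiM kM.
  by apply: kC; apply: abm_phi.
by apply: k2; apply: abm_phi.
Qed.

Definition pullback j : index_type := sval (cid (pullback_subproof j)).

Lemma pullbackE j g : rep (pullback j) g = rep j (phi g).
Proof. by rewrite /pullback; case: cid => j' /= ->. Qed.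

Fact pullback_inj : injective pullback.
Proof.
move=> i j ij; apply/val_inj/ffunP => x; rewrite -!rep_gen.
have [phi' phiK phi'K] := phiA.2.
by rewrite -[gen x]phi'K -!pullbackE ij.
Qed.

Definition twist_fun (y : Y) : Y := (pullback y.1, y.2).

Fact twist_inj : injective twist_fun.
Proof. by move=> [i x] [j y] [/pullback_inj -> ->]. Qed.

(** Permuting the copies of [X] realizes [phi] on the quotient as conjugation by a permutation (see
    [ev_phi]). *)
Definition twist : {perm Y} := perm twist_inj.

Lemma twistE g : twist * ev g = ev (phi g) * twist.
Proof.
apply/permP => -[j x].
by rewrite !permM evE !permE /twist_fun /ev_fun /= pullbackE.
Qed.

Lemma ev_phi g : ev (phi g) = ev g ^ twist^-1.
Proof. by rewrite conjgE invgK mulgA twistE mulgK. Qed.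

Lemma ev_iter_phi i g : ev (iter i phi g) = ev g ^ (twist^-1 ^+ i).
Proof.
elim: i => [|i IHi] /=; first by rewrite expg0 conjg1.
by rewrite ev_phi IHi -conjgM -expgSr.
Qed.

Definition fixedU : {set {perm Y}} := [set p in U | p ^ twist == p].

(* Burnside's lemma for Q acting by conjugation on the coset Q * twist, whose *)
(* orbits are the twisted conjugacy classes of Q.                             *)
Lemma card_fixedU (l : seq G) :
  (forall x, exists2 y, y \in l & twisted_conj phi x y) ->
  #|fixedU| <= size l * #|{: ZV}|.
Proof.
move=> lP; pose S := Q :* twist.
have twistQ g : ev g ^ twist^-1 \in Q by rewrite -ev_phi evQ.
have actS : [acts Q, on S | 'J].
  apply/subsetP => _ /QP[g ->]; rewrite !inE /=.
  apply/subsetP => _ /rcosetP[_ /QP[h ->] ->].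
  rewrite inE /= conjgE; apply/rcosetP.
  exists (ev (g^-1 * h * phi g)); first exact: evQ.
  by rewrite !evM evV -!mulgA -twistE !mulgA.
have orbits : #|orbit 'J Q @: S| <= size l.
  rewrite -(size_map (fun y => orbit 'J Q (ev y * twist))).
  apply: leq_trans (card_size _).
  apply/subset_leq_card/subsetP => _ /imsetP[_ /rcosetP[_ /QP[x ->] ->] ->].
  have [y yl [g xE]] := lP x; apply/mapP; exists y => //.
  apply/orbit_eqP/orbitP; exists (ev g^-1); first exact: evQ.
  by rewrite /= conjgE xE !evM -[_ * _ * twist]mulgA -twistE evV invgK !mulgA.
(* Such an [a] commutes with [twist] and with [U], hence fixes every point of the smaller coset
   [U :* twist]. *)
have fixS a : a \in fixedU -> #|U| <= #|'Fix_(S | 'J)[a]|.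
  rewrite inE => /andP[aU /eqP/conjg_fixP/commgP ca].
  rewrite -(card_rcoset U twist); apply/subset_leq_card/subsetP => _ /rcosetP[u uU ->].
  rewrite inE; apply/andP; split.
    by apply/rcosetP; exists u => //; apply: (subsetP sub_UQ).
  apply/afix1P => /=; apply/conjg_fixP/commgP/commute_sym/commuteM => //.
  exact: U_commute.
(* Of the sum in Burnside's lemma only the terms from [fixedU] are kept. *)
have FU : #|fixedU| * #|U| <= size l * #|Q|.
  apply: leq_trans (leq_mul orbits (leqnn _)); rewrite -(Frobenius_Cauchy actS).
  rewrite (big_setID fixedU) /= (setIidPr _); last first.
    by apply/subsetP => a; rewrite inE => /andP[/(subsetP sub_UQ)].
  by apply: leq_trans (leq_addr _ _); rewrite -sum_nat_const; apply: leq_sum.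
have U_gt0 : 0 < #|U| by apply/card_gt0P; exists 1; exact: U1.
rewrite -(leq_pmul2r U_gt0) (leq_trans FU) // -mulnA leq_mul2l.
by rewrite [(#|_| * #|U|)%N]mulnC card_Q orbT.
Qed.

Variables (s : V) (N : nat).
Hypothesis tau_iter : forall i, exists t a, iter i phi (tau s) = tau t ^ a.
Hypothesis N_gt0 : 0 < N.
Hypothesis fixN : forall g, ev (iter N phi (tau s ^ g)) = ev (tau s ^ g).

Definition tau_class : {set {perm Y}} := [set p | `[< exists g, p = ev (tau s ^ g) >]].

Lemma tau_classP p : reflect (exists g, p = ev (tau s ^ g)) (p \in tau_class).
Proof. by rewrite inE; apply: asboolP. Qed.

(** Conjugators lifting vectors supported off the link of [s] give distinct elements, told apart by
    the vectors over which they flip the bit. *)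
Lemma card_tau_class : q.+2 ^ #|~: link e s| <= #|tau_class|.
Proof.
pose f (z : ZV) := ev (tau s ^ abm_section e z).
have f_inj : {in pffun_on (0%R : Zq) (~: link e s) predT &, injective f}.
  move=> y z /pffun_onP[ys _] /pffun_onP[zs _] fyz.
  have [j jE] := rep_surj (shift_nice s).
  have := congr1 (fun p : {perm Y} => (p (j, (y, false))).2.2) fyz.
  rewrite !evE /= !jE !shift_tauJ // !abm_sectionK eqxx /=.
  rewrite (_ : [forall v, _] = true); last by apply/forallP => v; rewrite eqxx orbT.
  move=> /esym/forallP yz; apply/ffunP => v; apply/eqP.
  have [esv|] := boolP (v \in link e s); last first.
    by have := yz v; rewrite inE; case: (e s v).
  have off (w : ZV) : 0%R.-support w \subset ~: link e s -> w v = 0%R.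
    move=> /subsetP/(_ v); rewrite !inE; rewrite inE in esv; rewrite esv.
    by case: eqP => // _ /(_ isT).
  by rewrite !off.
have := card_in_imset f_inj; rewrite card_pffun_on card_ord => <-.
apply/subset_leq_card/subsetP => _ /imsetP[z _ ->].
by apply/tau_classP; exists (abm_section e z).
Qed.

Lemma iter_phiM i : {morph iter i phi : x y / x * y}.
Proof. by elim: i => // i IHi x y; rewrite !iterS IHi phiM. Qed.

Lemma tau_class_cycle x : x \in tau_class -> x ^: <[twist]> \subset taus.
Proof.
move=> /tau_classP[g ->]; apply/subsetP => _ /imsetP[c + ->].
rewrite -cycleV => /cycleP[i ->]; rewrite -ev_iter_phi (morphJg (iter_phiM i)).
have [t [a ->]] := tau_iter i; apply/tausP; exists t, (a * iter i phi g).
by rewrite conjgM.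
Qed.

Lemma card_tau_class_cycle x : x \in tau_class -> #|x ^: <[twist]>| <= N.
Proof.
move=> /tau_classP[g ->]; set x0 := ev _.
have xN k : x0 ^ (twist^-1 ^+ (k * N)) = x0.
  elim: k => [|k IHk]; first by rewrite mul0n expg0 conjg1.
  by rewrite mulSn expgnDr conjgM -ev_iter_phi fixN.
rewrite -[X in _ <= X]card_ord -cardsT.
apply: leq_trans (leq_imset_card (fun i : 'I_N => x0 ^ (twist^-1 ^+ i)) _).
apply/subset_leq_card/subsetP => _ /imsetP[c + ->].
rewrite -cycleV => /cycleP[i ->]; apply/imsetP.
exists (Ordinal (ltn_pmod i N_gt0)) => //=.
by rewrite {1}(divn_eq i N) expgnDr conjgM xN.
Qed.

Definition tau_orbits := [set x ^: <[twist]> | x in tau_class].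

Lemma card_tau_orbits : q.+2 ^ #|~: link e s| <= #|tau_orbits| * N.
Proof.
apply: leq_trans card_tau_class _.
have /subset_leq_card/leq_trans -> // : tau_class \subset cover tau_orbits.
  apply/subsetP => x xT; apply/bigcupP; exists (x ^: <[twist]>); first exact: imset_f.
  exact: class_refl.
apply: leq_trans (leq_card_cover _).1 _; rewrite -sum_nat_const.
by apply: leq_sum => _ /imsetP[x xT ->]; apply: card_tau_class_cycle.
Qed.

(** Every set of orbits yields a fixed element, the product over its union, and distinct sets yield
    distinct products by linear independence. *)
Lemma exp_tau_orbits : 2 ^ #|tau_orbits| <= #|fixedU|.
Proof.
have coverE (O : {set {set {perm Y}}}) x : O \subset tau_orbits ->
    (x ^: <[twist]> \in O) = (x \in cover O).
  move=> OT; apply/idP/bigcupP => [xO|[C CO xC]].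
    by exists (x ^: <[twist]>) => //; apply: class_refl.
  have /imsetP[y _ CE] := subsetP OT C CO.
  by rewrite CE in xC CO; rewrite (class_eqP xC).
have cover_taus (O : {set {set {perm Y}}}) : O \subset tau_orbits -> cover O \subset taus.
  move=> OT; apply/bigcupsP => _ /(subsetP OT)/imsetP[x xT ->].
  exact: tau_class_cycle.
pose f O := prod_taus (cover O).
have f_inj : {in powerset tau_orbits &, injective f}.
  move=> O1 O2; rewrite !powersetE => O1T O2T /prod_taus_inj O12.
  have cov : cover O1 = cover O2 by apply: O12; apply: cover_taus.
  apply/setP => C; have [/imsetP[x _ ->]|CT] := boolP (C \in tau_orbits).
    by rewrite !coverE // cov.
  by rewrite (contraNF (subsetP O1T C)) ?(contraNF (subsetP O2T C)).
rewrite -card_powerset -(card_in_imset f_inj).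
apply/subset_leq_card/subsetP => _ /imsetP[O + ->]; rewrite powersetE => OT.
rewrite inE prod_tausU ?cover_taus //=; apply/eqP/prod_taus_fixed.
  exact: cover_taus.
apply/setP => x; rewrite mem_conjg -!coverE //; congr (_ \in O).
by apply/class_eqP/memJ_class; rewrite groupV cycle_id.
Qed.

Lemma tau_orbits_bound (l : seq G) :
  (forall x, exists2 y, y \in l & twisted_conj phi x y) ->
  exists2 o, 2 ^ o <= size l * q.+2 ^ #|V| & q.+2 ^ #|~: link e s| <= o * N.
Proof.
move=> lP; exists #|tau_orbits|; last exact: card_tau_orbits.
apply: leq_trans exp_tau_orbits (leq_trans (card_fixedU lP) _).
by rewrite card_ffun card_ord.
Qed.

End Twisted.

End FiniteQuotient.

(** * Periods of the automorphism *)

Local Notation dvd2 j x := (((2 : int) ^+ j)%R %| x%R)%Z.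

Section Iterates.
Variables (V : finType) (e : rel V).
Hypothesis e_sym : symmetric e.
Hypothesis e_irr : irreflexive e.

Local Notation G := (VA e).
Local Notation tau := (@tau V e).
Local Notation sigma := (@sigma V e).

Lemma is_aut_iter (f : G -> G) i : is_aut f -> is_aut (iter i f).
Proof.
move=> [fM fb]; split; first by elim: i => // i IHi x y; rewrite !iterS IHi fM.
by elim: i => [|i IHi]; [exists id | apply: (bij_comp fb IHi)].
Qed.

Lemma is_aut_inv (f : G -> G) : is_aut f ->
  exists f', [/\ cancel f f', cancel f' f & {morph f' : x y / x * y}].
Proof.
move=> [fM [f' fK f'K]]; exists f'; split=> // x y.
by apply: (can_inj fK); rewrite fM !f'K.
Qed.

Lemma tau_conj_inj s t a b : tau s ^ a = tau t ^ b -> s = t.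
Proof.
move=> st; have := shift_tauJ e_sym s s a (abm 0 a) false.
rewrite st shift_tauJ // eqxx /=.
rewrite (_ : [forall v, _ || (_ == abm 0 a v)] = true); last first.
  by apply/forallP => v; rewrite eqxx orbT.
by move=> [/andP[/eqP ->]].
Qed.

Definition close_to_id (psi : G -> G) s j : Prop :=
  (exists2 a, psi (tau s) = tau s ^ a & forall v, dvd2 j (ab a v)) /\
  forall g v, dvd2 j (ab (psi g) v - ab g v).

(** A matrix 1 + 2^j A squares to 1 modulo 2^(j+1) as j >= 1, and the new conjugator [a * psi a]
    has, modulo 2^(j+1), twice the exponent sums of [a]. *)
Lemma close_to_id_comp psi s j : {morph psi : x y / x * y} -> 0 < j ->
  close_to_id psi s j -> close_to_id (psi \o psi) s j.+1.
Proof.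
move=> psiM j_gt0 [[a aE aj] psij].
have psi2j g v : (forall w, dvd2 j (ab g w)) ->
    dvd2 j.+1 (ab (psi g) v - ab g v).
  move=> gj; rewrite (ab_morph psiM) (ab_morph (psi := id)) // -sumrB.
  apply: rpred_sum => t _; rewrite -mulrBr.
  apply: (@dvdz_trans (2 ^+ j * 2 ^+ j)%R); last exact: dvdz_mul.
  by rewrite -exprD dvdz_exp2l //; lia.
have tw2 x : dvd2 j x -> dvd2 j.+1 (x + x).
  by move=> jx; rewrite -mulr2n -[(x *+ 2)%R]mulr_natl exprS; apply: dvdz_mul.
split=> [|g v].
  exists (a * psi a); first by rewrite /= aE (morphJg psiM) aE conjgM.
  move=> v; rewrite abM ffunE.
  have -> : (ab a v + ab (psi a) v = (ab a v + ab a v) + (ab (psi a) v - ab a v))%R by lia.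
  by rewrite rpredD ?tw2 ?psi2j.
have -> : (ab ((psi \o psi) g) v - ab g v =
    (ab (psi g) v - ab g v + (ab (psi g) v - ab g v)) +
    (ab (psi (psi g * g^-1)%g) v - ab (psi g * g^-1)%g v))%R.
  by rewrite psiM !abM (morphVg psiM) !abV !ffunE /=; lia.
rewrite rpredD ?tw2 ?psi2j // => w.
by rewrite abM abV !ffunE psij.
Qed.

Section Aut.
Variables (phi : G -> G) (s : V).
Hypothesis phiA : is_aut phi.
Hypothesis s_max : forall t, #|link e t| <= #|link e s|.

Lemma iter_tau i : exists t a, iter i phi (tau s) = tau t ^ a.
Proof.
have [a [t [tE _ _]]] := aut_tau e_sym e_irr (is_aut_iter i phiA) s_max.
by exists t, a.
Qed.

(** Pigeonhole: the vertex, the conjugator modulo 2 and the matrix modulo 2 of an iterate take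
    finitely many values. Two iterates share them, and undoing one of them in the other leaves an
    iterate close to the identity. *)
Lemma iterate_close_to_id : exists2 c, 0 < c & close_to_id (iter c phi) s 1.
Proof.
have [t /choice[a aE]] := choice iter_tau.
pose D := (V * {ffun V -> 'Z_2} * {ffun V -> {ffun V -> 'Z_2}})%type.
pose d (i : 'I_#|{: D}|.+1) : D :=
  (t i, abm 0 (a i), [ffun v => abm 0 (iter i phi (sigma v))]).
have /injectivePn[i [j ij dij]] : ~~ injectiveb d.
  by apply/negP => /injectiveP/leq_card; rewrite card_ord ltnn.
wlog {ij} ij : i j dij / i < j.
  move=> IH; case: (ltngtP i j) => [|/IH|/ord_inj/eqP].
  - exact: IH.
  - exact.
  - by rewrite (negPf ij).
exists (j - i); first by rewrite subn_gt0.
case: dij => tij aij /ffunP sij.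
have [f' [fK f'K f'M]] := is_aut_inv (is_aut_iter i phiA).
have fM := (is_aut_iter i phiA).1.
have iterE g : iter i phi (iter (j - i) phi g) = iter j phi g.
  by rewrite -iterD subnKC // ltnW.
have dvd_ab (g h : G) v : abm 0 g = abm 0 h -> dvd2 1 (ab g v - ab h v).
  move=> /ffunP/(_ v); rewrite !ffunE => gh.
  by rewrite expr1 -intr_Zp_eq0 rmorphB /= gh subrr.
split=> [|g v].
  exists (f' ((a i)^-1 * a j)).
    apply: (can_inj fK); rewrite iterE (morphJg fM) f'K.
    by rewrite !aE -tij -conjgM mulKVg.
  move=> v; set b := f' _; rewrite (_ : ab b v = (ab b v - ab (1%g : G) v)%R); last first.
    by rewrite ab1 ffunE subr0.
  apply: dvd_ab; rewrite -[1 in RHS](morph1g f'M); apply: (abm_morph f'M).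
  by rewrite abmM abmV aij addNr abm1.
apply: dvd_ab; rewrite -[g in RHS]fK -[iter _ _ g in LHS]fK.
apply: (abm_morph f'M); rewrite iterE.
apply/ffunP => w; rewrite !ffunE (ab_morph fM) (ab_morph (is_aut_iter j phiA).1).
rewrite !rmorph_sum; apply: eq_bigr => x _; rewrite !rmorphM /=; congr (_ * _)%R.
by have := sij x; rewrite !ffunE => /ffunP/(_ w); rewrite !ffunE.
Qed.

(** Here [v] is adjacent to every other vertex [u], so [psi (sigma u)] commutes with [psi (tau v)]
    and has zero exponent sum at [t]. Surjectivity makes the one remaining matrix entry a unit. *)
Lemma aut_coordinate psi v : is_aut psi -> #|link e v| = #|link e s| ->
  #|~: link e v| = 1%N -> exists a t (eps : int),
  [/\ psi (tau v) = tau t ^ a, #|link e t| = #|link e v|, eps = 1%R \/ eps = (-1)%R &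
    forall g, ab (psi g) t = (ab g v * eps)%R].
Proof.
move=> psiA vs v1.
have [|a [t [tE tl comm]]] := aut_tau e_sym e_irr psiA (s := v).
  by move=> t; rewrite vs.
have linkv u : u != v -> e v u.
  have /eqP/cards1P[w wE] := v1.
  have : v \in ~: link e v by rewrite !inE e_irr.
  rewrite wE inE => /eqP vw uv; have : u \notin ~: link e v by rewrite wE inE -vw.
  by rewrite !inE negbK.
have [psiM [psi' psiK psi'K]] := psiA.
have abE g : ab (psi g) t = (ab g v * ab (psi (sigma v)) t)%R.
  rewrite (ab_morph psiM) (bigD1 v) //= big1 ?addr0 // => u uv.
  rewrite (comm (psi (sigma u)) t) ?mulr0 ?e_irr // /commute -!psiM.
  by congr psi; apply/esym/gen_commute => //=; apply: linkv.
exists a, t, (ab (psi (sigma v)) t); split=> //.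
have /(congr1 absz) := abE (psi' (sigma t)); rewrite psi'K ab_sigma eqxx abszM.
move=> /esym/eqP; rewrite muln_eq1 => /andP[_ /eqP]; move: (ab _ _) => x; lia.
Qed.

(** The last clause covers at once periods N linear in the modulus when the complement of the link
    has at least two elements, and N bounded when it has one. *)
Definition bounded_periods (C : nat) : Prop := forall q k, q.+2 = (2 ^ k.+1)%N ->
  exists N, [/\ 0 < N,
    forall g, ev q (iter N phi (tau s ^ g)) = ev q (tau s ^ g) &
    forall o, (q.+2 ^ #|~: link e s| <= o * N -> q.+2 <= o * C)%N].

Lemma bounded_periods_ge2 : 2 <= #|~: link e s| ->
  exists2 C, 0 < C & bounded_periods C.
Proof.
move=> r2; have [c c_gt0 close1] := iterate_close_to_id.
exists c => // q k qk.
have close j : close_to_id (iter (2 ^ j * c)%N phi) s j.+1.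
  elim: j => [|j IHj]; first by rewrite mul1n.
  rewrite expnS mul2n -addnn mulnDl.
  set n := (2 ^ j * c)%N; have -> : iter (n + n) phi = iter n phi \o iter n phi.
    by apply: funext => g; rewrite iterD.
  by apply: close_to_id_comp => //; case: (is_aut_iter n phiA).
exists (2 ^ k * c)%N; split=> [|g|o].
- by rewrite muln_gt0 expn_gt0.
- have [[a aE ak] closek] := close k.
  rewrite (morphJg (is_aut_iter _ phiA).1) aE -conjgM; apply: ev_tauJ_eq => // v _.
  apply/eqP; rewrite -subr_eq0 !ffunE -rmorphB intr_Zp_eq0.
  have -> : (q.+2 : int) = (2 ^+ k.+1)%R by rewrite qk -natrX natz.
  by rewrite abM ffunE -addrA rpredD.
(* With m = 2^(k+1) and r >= 2, m^r is at least m * 2 * 2^k; the factor 2^k cancels against the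
   period. *)
- have q2 : (q.+2 * (2 * 2 ^ k) <= q.+2 ^ #|~: link e s|)%N.
    by rewrite -expnS -qk mulnn leq_exp2l.
  move=> /(leq_trans q2) qo.
  have : (q.+2 * 2 ^ k <= o * c * 2 ^ k)%N.
    apply: leq_trans (leq_trans qo _); last by rewrite mulnA mulnAC.
    by rewrite leq_mul2l leq_pmull ?orbT.
  by rewrite leq_pmul2r // expn_gt0.
Qed.

Lemma bounded_periods_or_invariant : #|~: link e s| = 1%N ->
  (exists2 C, 0 < C & bounded_periods C) \/
  exists lam : G -> int, [/\ forall g h, lam (g * h) = (lam g + lam h)%R,
    forall g, lam (phi g) = lam g & lam (sigma s) = 1%R].
Proof.
move=> r1; have max1 v : #|link e v| = #|link e s| -> #|~: link e v| = 1%N.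
  by have := cardsC (link e v); have := cardsC (link e s); rewrite r1; lia.
have exp : exists n, (0 < n) && `[< exists a, iter n phi (tau s) = tau s ^ a >].
  have [c c_gt0 [[a aE _] _]] := iterate_close_to_id.
  by exists c; rewrite c_gt0; apply/asboolP; exists a.
case: (ex_minnP exp) => p /andP[p_gt0 /asboolP[b bE]] p_min {exp}.
have [a [t [eps [tE _ epsE abE]]]] := aut_coordinate (is_aut_iter p phiA) erefl r1.
have ts : t = s by apply/esym/(tau_conj_inj (a := b) (b := a)); rewrite -bE -tE.
have [pM _] := is_aut_iter p phiA.
rewrite {}ts {t tE a} in abE; case: epsE => epsE; rewrite {}epsE in abE; [right|left].
  (* Summing over one return time gives an invariant: [phi] shifts the terms cyclically, as the
     [p]-th iterate preserves the exponent sum at [s]. *)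
  pose lam g := (\sum_(i < p) ab (iter i phi g) s)%R; exists lam; split.
  - move=> g h; rewrite /lam -big_split; apply: eq_bigr => i _ /=.
    by rewrite (is_aut_iter i phiA).1 abM ffunE.
  - move=> g; rewrite /lam; case: (p) p_gt0 abE => // n _ abE.
    rewrite big_ord_recr big_ord_recl /= addrC -iterSr abE mulr1; congr (_ + _)%R.
    by apply: eq_bigr => i _; rewrite -iterSr.
  - rewrite /lam; case: (p) p_gt0 p_min bE => // n _ p_min bE.
    rewrite big_ord_recl /= ab_sigma eqxx big1 ?addr0 // => i _.
    rewrite [X in ab X _](_ : _ = iter i.+1 phi (sigma s)) //; set m := i.+1.
    have mn : m <= n by apply: ltn_ord.
    (* By minimality of [p] this [v] is not [s]. The [m]-th iterate carries it back to [s], so the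
       exponent sum at [s] after it is, up to sign, the one at [v] before, which vanishes for
       [sigma s]. *)
    have [a [v [_ [vE vl _ _]]]] := aut_coordinate (is_aut_iter (n.+1 - m) phiA) erefl r1.
    have vs : v != s.
      apply/eqP => vs; have /p_min : (0 < n.+1 - m) &&
          `[< exists a, iter (n.+1 - m) phi (tau s) = tau s ^ a >].
        by rewrite subn_gt0 ltnS mn; apply/asboolP; exists a; rewrite vE vs.
      by rewrite /m; lia.
    have [c [w [d [wE _ _ wab]]]] := aut_coordinate (is_aut_iter m phiA) vl (max1 _ vl).
    have ws : w = s.
      apply: (tau_conj_inj (a := c * iter m phi a) (b := b)).
      rewrite -bE conjgM -wE -(morphJg (is_aut_iter m phiA).1) -vE -iterD.
      by rewrite subnKC // ltnW.
    by rewrite ws in wab; rewrite wab ab_sigma (negPf vs) mul0r.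
(* The [p]-th iterate acts on the conjugates as x |-> c - x, an involution, so 2p is a period for
   every modulus. *)
exists (p + p)%N => [|q k qk]; first by rewrite addn_gt0 p_gt0.
exists (p + p)%N; split=> [|g|o]; rewrite ?addn_gt0 ?p_gt0 //; last first.
  by rewrite r1 expn1.
rewrite iterD !(morphJg pM) bE (morphJg pM) bE -!conjgM; apply: ev_tauJ_eq => // v esv.
have -> : v = s.
  have /eqP/cards1P[w wE] := r1.
  have : v \in ~: link e s by rewrite !inE.
  have : s \in ~: link e s by rewrite !inE e_irr.
  by rewrite wE !inE => /eqP -> /eqP ->.
rewrite !ffunE; congr (_%:~R)%R.
by rewrite !abM !ffunE !abE !mulrN1 opprK addrA subrr add0r.
Qed.

End Aut.

End Iterates.

(** * From finitely many twisted classes to a contradiction *)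

Lemma reidemeister_reps (G : groupType) (phi : G -> G) :
  {morph phi : x y / x * y} -> reidemeister phi <> None ->
  exists l : seq G, forall x, exists2 y, y \in l & twisted_conj phi x y.
Proof.
move=> phiM; rewrite /reidemeister; case: asboolP => // /cardinality.finite_seqP[r rE] _.
have phi1 : phi 1 = 1 by apply: (@mulgI _ (phi 1)); rewrite -phiM !mulg1.
have [l lE] : exists l : seq G, forall x, twisted_class phi x \in r ->
    exists2 y, y \in l & twisted_class phi y = twisted_class phi x.
  elim: {rE} r => [|C r [l IHl]]; first by exists [::].
  have [[y yC]|nC] := pselect (exists y, twisted_class phi y = C).
    exists (y :: l) => x; rewrite inE => /predU1P[->|/IHl[z zl zE]].
      by exists y; rewrite ?mem_head.
    by exists z; rewrite // inE zl orbT.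
  exists l => x; rewrite inE => /predU1P[xC|/IHl//].
  by case: nC; exists x.
exists l => x; have [|y yl yx] := lE x.
  suff : twisted_classes phi (twisted_class phi x) by rewrite rE.
  by exists x.
exists y => //; have : twisted_class phi x x by exists 1; rewrite mul1g invg1 phi1 mulg1.
by rewrite -yx.
Qed.

Lemma exp_linear_unbounded L n C :
  ~ (forall k, exists2 o, (2 ^ o <= L * (2 ^ k.+1) ^ n)%N & (2 ^ k.+1 <= o * C)%N).
Proof.
move=> bounded.
have oE k : (2 ^ k.+1 <= (L + k.+1 * n) * C)%N.
  have [o oL oC] := bounded k; apply: leq_trans oC _; rewrite leq_mul2r.
  apply/orP; right; rewrite -(leq_exp2l (m := 2)) // (leq_trans oL) //.
  by rewrite expnD -expnM leq_mul2r ltnW ?orbT // ltn_expl.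
(* For k + 1 = 2M the power 2^(k+1) exceeds M^2, and [M] is chosen so that M^2 dominates the linear
   bound [oE]. *)
pose M := ((L + n) * C).*2.+1.
have M2 : (M * M < 2 ^ M * 2 ^ M)%N by apply: ltn_mul; apply: ltn_expl.
have := oE M.*2.-1; rewrite prednK ?double_gt0 // -addnn expnD.
have : ((L + (M + M) * n) * C <= M * M)%N by rewrite /M; nia.
by lia.
Qed.

Theorem theorem4p2 (V : finType) (e : rel V) (e_sym : symmetric e)
    (e_irr : irreflexive e) (V_gt0 : (0 < #|V|)%N) : Rinf_property (VA e).
Proof.
move=> phi phi_bij; have phiM : {morph phi : x y / x * y} by apply: gmulfM.
apply: contrapT => /(reidemeister_reps phiM)[l lP].
have phiA : is_aut phi by [].
have /card_gt0P[s0 _] := V_gt0.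
have [s _ s_max'] := @arg_maxnP _ s0 xpredT (fun t => #|link e t|) isT.
have s_max t : (#|link e t| <= #|link e s|)%N by apply: s_max'.
(* Bounded periods give a number of orbits at least linear in the modulus, hence exponentially many
   fixed elements, whereas finitely many classes allow only polynomially many. *)
have not_bounded C : ~ bounded_periods phi s C.
  move=> bounded; apply: (@exp_linear_unbounded (size l) #|V| C) => k.
  have qk : ((2 ^ k.+1 - 2).+2 = 2 ^ k.+1)%N.
    by have := expn_gt0 2 k; rewrite expnS; lia.
  have [N [N_gt0 fixN NC]] := bounded _ _ qk.
  have iterT := iter_tau e_sym e_irr phiA s_max.
  have [o oL oN] := tau_orbits_bound e_sym phiA iterT N_gt0 fixN lP.
  by exists o; rewrite -qk // NC.
have s_link : s \in ~: link e s by rewrite !inE e_irr.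
have [r2|r1] := leqP 2 #|~: link e s|.
  by have [C _ /not_bounded] := bounded_periods_ge2 e_sym e_irr phiA s_max r2.
have {}r1 : #|~: link e s| = 1%N.
  by apply/eqP; rewrite eqn_leq -ltnS r1; apply/card_gt0P; exists s.
have [[C _ /not_bounded//]|[lam [lamM lam_phi lam_s]]] :=
  bounded_periods_or_invariant e_sym e_irr phiA s_max r1.
have lam1 : lam 1 = 0%R by have := lamM 1 1; rewrite mulg1; lia.
have lamV g : lam g^-1 = (- lam g)%R by have := lamM g g^-1; rewrite mulgV lam1; lia.
have lamX n : lam (sigma e s ^+ n) = n%:Z%R.
  by elim: n => [|n IHn]; rewrite ?expg0 // expgS lamM IHn lam_s; lia.
have lam_l x : exists2 y, y \in l & lam x = lam y.
  have [y yl [g ->]] := lP x; exists y => //.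
  by rewrite !lamM lam_phi lamV; lia.
(* The invariant [lam] is constant on twisted classes, hence takes only the values it has on [l];
   this power of [sigma s] exceeds them all. *)
have [y yl] := lam_l (sigma e s ^+ (\sum_(y <- l) absz (lam y)).+1).
rewrite lamX => yE.
have : (absz (lam y) <= \sum_(y <- l) absz (lam y))%N.
  by rewrite (big_rem y yl) leq_addr.
by rewrite -yE; lia.
Qed.
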